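(* Let $n\ge 1$ be an integer. The map $\phi\colon \mathcal{E}_n(1)\to P_n^{\ltimes}$ given on generators, for $i=1,\dots,n-1$, by $$E_i\mapsto (1,A^{i,i+1}),\qquad T_i\mapsto(\sigma_{i,i+1},\sigma_{i,i+1})$$ defines an isomorphism of $\mathbb{C}$-algebras, where $P_n^{\ltimes}$ is the small ramified partition algebra over $\mathbb{C}$.
   Context: **Juyumaya algebra.** Let $\mathcal{A}=\mathbb{C}[u,u^{-1}]$. $\mathcal{E}_n^{\mathcal{A}}(u)$ is the unital associative $\mathcal{A}$-algebra generated by $T_1,\dots,T_{n-1},E_1,\dots,E_{n-1}$ with defining relations (A1) $T_iT_j=T_jT_i$ if $|i-j|>1$; (A2) $E_iE_j=E_jE_i$ for all $i,j$; (A3) $E_i^2=E_i$; (A4) $E_iT_i=T_iE_i$; (A5) $E_iT_j=T_jE_i$ if $|i-j|>1$; (A6) $T_iT_jT_i=T_jT_iT_j$ if $|i-j|=1$; (A7) $E_jT_iT_j=T_iT_jE_i$ if $|i-j|=1$; (A8) $E_iE_jT_j=E_iT_jE_i=T_jE_iE_j$ if $|i-j|=1$; (A9) $T_i^2=1+(u-1)E_i(1-T_i)$. For a nonzero complex number $x$, $\mathcal{E}_n(x)=\mathcal{E}_n^{\mathcal{A}}(u)\otimes_{\mathcal{A}}\mathbb{C}$, where $\mathbb{C}$ is an $\mathcal{A}$-algebra via $u\mapsto x$. The images of the generators in $\mathcal{E}_n(x)$ are again denoted $T_i,E_i$. **Partitions.** Let $\underline{n}=\{1,\dots,n\}$, $\underline{n}'=\{1',\dots,n'\}$,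 and let $\mathcal{P}_{\underline{n}\cup\underline{n}'}$ be the set of set partitions of $\underline{n}\cup\underline{n}'$. Partitions are composed as partition diagrams: draw $p$ (top vertices $1,\dots,n$, bottom vertices $1',\dots,n'$) above $q$, identify the bottom vertex $i'$ of $p$ with the top vertex $i$ of $q$ for each $i$, and let $pq$ be the partition of the remaining top and bottom vertices induced by connectedness in the stacked diagram (connected components containing only middle vertices would contribute scalar parameters, but none occur for the products used here). The symmetric group $S_n$ is identified with the set of partitions all of whose parts have the form $\{i,j'\}$ with $i,j\in\underline{n}$, with this composition as its product. In particular $1=\{\{1,1'\},\dots,\{n,n'\}\}$; $\sigma_{i,j}$ is the transposition, with parts $\{i,j'\},\{j,i'\}$ and $\{k,k'\}$ for $k\ne i,j$. Also $A^{i,j}$ is the partition with parts $\{i,i',j,j'\}$ and $\{k,k'\}$ for $k\neq i,j$. Let $\text{diag-}\mathcal{P}_n$ be the set of $b\in\mathcal{P}_{\underline{n}\cup\underline{n}'}$ such that $i$ and $i'$ lie in the same part of $b$ for every $i\in\underline{n}$. **Small ramified partition algebra.** Let $\ltimes\colon S_n\times\text{diag-}\mathcal{P}_n\to S_n\times\mathcal{P}_{\underline{n}\cup\underline{n}'}$, $(a,b)\mapsto(a,ba)$. The algebra $P_n^{\ltimes}$ over a field $F$ is the free $F$-module with basis $\ltimes(S_n\times\text{diag-}\mathcal{P}_n)$ and multiplication given on basis elements by componentwise composition of partitions, $(p_1,p_2)(q_1,q_2)=(p_1q_1,p_2q_2)$. *)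

(* Defs.v *)
From HB Require Import structures.
From mathcomp Require Import all_boot all_order all_algebra fingroup perm.
From mathcomp Require Import fraction generic_quotient.
From mathcomp Require Import boolp reals.
From mathcomp Require Import complex.

Set Implicit Arguments.
Unset Strict Implicit.
Unset Printing Implicit Defensive.

Import GRing.Theory.
Local Open Scope ring_scope.
Local Open Scope quotient_scope.

(* Associative unital algebras given by generators and relations: formal      *)
(* algebra expressions modulo the least congruence that contains the axioms   *)
(* of associative unital A-algebras and the prescribed relations.             *)

Section Presentation.
Variables (A : comNzRingType) (X : Type).

Inductive term :=
  | Gen of X
  | Zero
  | One
  | Add of term & term
  | Opp of term
  | Mul of term & term
  | Scale of A & term.

Variable r : term -> term -> Prop.

Inductive alg_congr : term -> term -> Prop :=
  | ac_rel s t : r s t -> alg_congr s t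
  | ac_refl s : alg_congr s s
  | ac_sym s t : alg_congr s t -> alg_congr t s
  | ac_trans s t w : alg_congr s t -> alg_congr t w -> alg_congr s w
  | ac_add s s' t t' :
      alg_congr s s' -> alg_congr t t' -> alg_congr (Add s t) (Add s' t')
  | ac_opp s s' : alg_congr s s' -> alg_congr (Opp s) (Opp s')
  | ac_mul s s' t t' :
      alg_congr s s' -> alg_congr t t' -> alg_congr (Mul s t) (Mul s' t')
  | ac_scale a s s' : alg_congr s s' -> alg_congr (Scale a s) (Scale a s')
  | ac_addA s t w : alg_congr (Add s (Add t w)) (Add (Add s t) w)
  | ac_addC s t : alg_congr (Add s t) (Add t s)
  | ac_add0 s : alg_congr (Add Zero s) s
  | ac_addN s : alg_congr (Add (Opp s) s) Zero
  | ac_mulA s t w : alg_congr (Mul s (Mul t w)) (Mul (Mul s t) w)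
  | ac_mul1l s : alg_congr (Mul One s) s
  | ac_mul1r s : alg_congr (Mul s One) s
  | ac_mulDl s t w : alg_congr (Mul (Add s t) w) (Add (Mul s w) (Mul t w))
  | ac_mulDr s t w : alg_congr (Mul s (Add t w)) (Add (Mul s t) (Mul s w))
  | ac_scaleA a b s : alg_congr (Scale a (Scale b s)) (Scale (a * b) s)
  | ac_scale1 s : alg_congr (Scale 1 s) s
  | ac_scaleDr a s t :
      alg_congr (Scale a (Add s t)) (Add (Scale a s) (Scale a t))
  | ac_scaleDl a b s :
      alg_congr (Scale (a + b) s) (Add (Scale a s) (Scale b s))
  | ac_scaleAl a s t : alg_congr (Scale a (Mul s t)) (Mul (Scale a s) t)
  | ac_scaleAr a s t : alg_congr (Scale a (Mul s t)) (Mul s (Scale a t)).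

Definition alg_congrb : rel {classic term} := fun s t => `[< alg_congr s t >].

Lemma alg_congrb_refl : reflexive alg_congrb.
Proof. by move=> s; apply/asboolP; apply: ac_refl. Qed.

Lemma alg_congrb_sym : symmetric alg_congrb.
Proof. by move=> s t; apply/asboolP/asboolP; apply: ac_sym. Qed.

Lemma alg_congrb_trans : transitive alg_congrb.
Proof.
by move=> t s w /asboolP st /asboolP tw; apply/asboolP; apply: ac_trans st tw.
Qed.

Canonical alg_congr_equiv :=
  EquivRel alg_congrb alg_congrb_refl alg_congrb_sym alg_congrb_trans.

Definition presented := {eq_quot alg_congr_equiv}.

HB.instance Definition _ := Choice.on presented.
HB.instance Definition _ := EqQuotient.on presented.

Definition pclass (s : term) : presented := \pi_presented (s : {classic term}).

Lemma pclassP s t : pclass s = pclass t <-> alg_congr s t.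
Proof.
split=> [|st].
  by move/eqmodP/asboolP.
by apply/eqmodP/asboolP.
Qed.

Lemma prepr (x : presented) : {s : term | x = pclass s}.
Proof. by exists (repr x); rewrite /pclass reprK. Qed.

Definition padd (x y : presented) := pclass (Add (repr x) (repr y)).
Definition popp (x : presented) := pclass (Opp (repr x)).
Definition pmul (x y : presented) := pclass (Mul (repr x) (repr y)).
Definition pscale a (x : presented) := pclass (Scale a (repr x)).

Lemma repr_pclass s : alg_congr (repr (pclass s)) s.
Proof. by apply/pclassP; rewrite /pclass reprK. Qed.

Lemma paddE s t : padd (pclass s) (pclass t) = pclass (Add s t).
Proof. by apply/pclassP; apply: ac_add; apply: repr_pclass. Qed.
Lemma poppE s : popp (pclass s) = pclass (Opp s).
Proof. by apply/pclassP; apply: ac_opp; apply: repr_pclass. Qed.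
Lemma pmulE s t : pmul (pclass s) (pclass t) = pclass (Mul s t).
Proof. by apply/pclassP; apply: ac_mul; apply: repr_pclass. Qed.
Lemma pscaleE a s : pscale a (pclass s) = pclass (Scale a s).
Proof. by apply/pclassP; apply: ac_scale; apply: repr_pclass. Qed.
Definition pE := (paddE, poppE, pmulE, pscaleE).

Lemma paddA : associative padd.
Proof.
move=> x y z; case: (prepr x) (prepr y) (prepr z) => s -> [t ->] [w ->].
by rewrite !pE; apply/pclassP; constructor.
Qed.
Lemma paddC : commutative padd.
Proof.
move=> x y; case: (prepr x) (prepr y) => s -> [t ->].
by rewrite !pE; apply/pclassP; constructor.
Qed.
Lemma padd0 : left_id (pclass Zero) padd.
Proof.
by move=> x; case: (prepr x) => s ->; rewrite !pE; apply/pclassP; constructor.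
Qed.
Lemma paddN : left_inverse (pclass Zero) popp padd.
Proof.
by move=> x; case: (prepr x) => s ->; rewrite !pE; apply/pclassP; constructor.
Qed.

HB.instance Definition _ :=
  GRing.isZmodule.Build presented paddA paddC padd0 paddN.

Lemma pmulA : associative pmul.
Proof.
move=> x y z; case: (prepr x) (prepr y) (prepr z) => s -> [t ->] [w ->].
by rewrite !pE; apply/pclassP; constructor.
Qed.
Lemma pmul1l : left_id (pclass One) pmul.
Proof.
by move=> x; case: (prepr x) => s ->; rewrite !pE; apply/pclassP; constructor.
Qed.
Lemma pmul1r : right_id (pclass One) pmul.
Proof.
by move=> x; case: (prepr x) => s ->; rewrite !pE; apply/pclassP; constructor.
Qed.
Lemma pmulDl : left_distributive pmul (@GRing.add presented).
Proof.
move=> x y z; case: (prepr x) (prepr y) (prepr z) => s -> [t ->] [w ->].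
by rewrite /GRing.add /= !pE; apply/pclassP; constructor.
Qed.
Lemma pmulDr : right_distributive pmul (@GRing.add presented).
Proof.
move=> x y z; case: (prepr x) (prepr y) (prepr z) => s -> [t ->] [w ->].
by rewrite /GRing.add /= !pE; apply/pclassP; constructor.
Qed.

HB.instance Definition _ :=
  GRing.Zmodule_isPzRing.Build presented pmulA pmul1l pmul1r pmulDl pmulDr.

Lemma pscaleA a b x : pscale a (pscale b x) = pscale (a * b) x.
Proof. by case: (prepr x) => s ->; rewrite !pE; apply/pclassP; constructor. Qed.
Lemma pscale1 : left_id 1 pscale.
Proof.
by move=> x; case: (prepr x) => s ->; rewrite !pE; apply/pclassP; constructor.
Qed.
Lemma pscaleDr : right_distributive pscale (@GRing.add presented).
Proof.
move=> a x y; case: (prepr x) (prepr y) => s -> [t ->].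
by rewrite /GRing.add /= !pE; apply/pclassP; constructor.
Qed.
Lemma pscaleDl x : {morph pscale^~ x : a b / a + b}.
Proof.
move=> a b; case: (prepr x) => s ->.
by rewrite {2}/GRing.add /= !pE; apply/pclassP; constructor.
Qed.

HB.instance Definition _ := GRing.Zmodule_isLmodule.Build A presented
  pscaleA pscale1 pscaleDr pscaleDl.

Lemma pscaleAl (a : A) (x y : presented) : a *: (x * y) = a *: x * y.
Proof.
case: (prepr x) (prepr y) => s -> [t ->].
by rewrite /GRing.scale /GRing.mul /= !pE; apply/pclassP; constructor.
Qed.
Lemma pscaleAr (a : A) (x y : presented) : a *: (x * y) = x * (a *: y).
Proof.
case: (prepr x) (prepr y) => s -> [t ->].
by rewrite /GRing.scale /GRing.mul /= !pE; apply/pclassP; constructor.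
Qed.

Fixpoint term_eval (B : algType A) (g : X -> B) (s : term) : B :=
  match s with
  | Gen x => g x
  | Zero => 0
  | One => 1
  | Add s t => term_eval g s + term_eval g t
  | Opp s => - term_eval g s
  | Mul s t => term_eval g s * term_eval g t
  | Scale a s => a *: term_eval g s
  end.

Lemma term_eval_congr (B : algType A) (g : X -> B) :
    (forall s t, r s t -> term_eval g s = term_eval g t) ->
  forall s t, alg_congr s t -> term_eval g s = term_eval g t.
Proof.
move=> rg s t; elim => //=.
- by move=> ? ? ? _ -> _ ->.
- by move=> ? ? ? ? _ -> _ ->.
- by move=> ? ? _ ->.
- by move=> ? ? ? ? _ -> _ ->.
- by move=> ? ? ? _ ->.
- by move=> *; rewrite addrA.
- by move=> *; rewrite addrC.
- by move=> *; rewrite add0r.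
- by move=> *; rewrite addNr.
- by move=> *; rewrite mulrA.
- by move=> *; rewrite mul1r.
- by move=> *; rewrite mulr1.
- by move=> *; rewrite mulrDl.
- by move=> *; rewrite mulrDr.
- by move=> *; rewrite scalerA.
- by move=> *; rewrite scale1r.
- by move=> *; rewrite scalerDr.
- by move=> *; rewrite scalerDl.
- by move=> *; rewrite scalerAl.
- by move=> *; rewrite scalerAr.
Qed.

Definition presented_lift (B : algType A) (g : X -> B) (x : presented) : B :=
  term_eval g (repr x).

Lemma presented_liftE (B : algType A) (g : X -> B) :
    (forall s t, r s t -> term_eval g s = term_eval g t) ->
  forall s, presented_lift g (pclass s) = term_eval g s.
Proof. by move=> rg s; apply: term_eval_congr => //; apply: repr_pclass. Qed.

End Presentation.

Arguments Gen {A X}.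
Arguments Zero {A X}.
Arguments One {A X}.

(* Juyumaya's algebra of braids and ties. The indices 1, ..., n - 1 of the    *)
(* generators are represented by 0, ..., n - 2.                               *)

Inductive juyumaya_gen n := GenT of 'I_n.-1 | GenE of 'I_n.-1.

Definition far n (i j : 'I_n.-1) := (i.+1 < j)%N || (j.+1 < i)%N.
Definition adjacent n (i j : 'I_n.-1) := (i.+1 == j)%N || (j.+1 == i)%N.

Section JuyumayaPresentation.
Variables (A : comNzRingType) (u : A) (n : nat).

Local Notation "'T_ i" := (Gen (GenT i)) (at level 8, i at level 2).
Local Notation "'E_ i" := (Gen (GenE i)) (at level 8, i at level 2).
Local Notation "s ⋅ t" := (Mul s t) (at level 40, left associativity).
Local Notation "s ⊞ t" := (Add s t) (at level 50, left associativity).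

Inductive juyumaya_rel :
    term A (juyumaya_gen n) -> term A (juyumaya_gen n) -> Prop :=
  | jrA1 i j : far i j -> juyumaya_rel ('T_i ⋅ 'T_j) ('T_j ⋅ 'T_i)
  | jrA2 i j : juyumaya_rel ('E_i ⋅ 'E_j) ('E_j ⋅ 'E_i)
  | jrA3 i : juyumaya_rel ('E_i ⋅ 'E_i) 'E_i
  | jrA4 i : juyumaya_rel ('E_i ⋅ 'T_i) ('T_i ⋅ 'E_i)
  | jrA5 i j : far i j -> juyumaya_rel ('E_i ⋅ 'T_j) ('T_j ⋅ 'E_i)
  | jrA6 i j : adjacent i j ->
      juyumaya_rel ('T_i ⋅ 'T_j ⋅ 'T_i) ('T_j ⋅ 'T_i ⋅ 'T_j)
  | jrA7 i j : adjacent i j ->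
      juyumaya_rel ('E_j ⋅ 'T_i ⋅ 'T_j) ('T_i ⋅ 'T_j ⋅ 'E_i)
  | jrA8l i j : adjacent i j ->
      juyumaya_rel ('E_i ⋅ 'E_j ⋅ 'T_j) ('E_i ⋅ 'T_j ⋅ 'E_i)
  | jrA8r i j : adjacent i j ->
      juyumaya_rel ('E_i ⋅ 'T_j ⋅ 'E_i) ('T_j ⋅ 'E_i ⋅ 'E_j)
  | jrA9 i :
      juyumaya_rel ('T_i ⋅ 'T_i)
                   (One ⊞ Scale (u - 1) ('E_i ⋅ (One ⊞ Opp 'T_i))).

Definition juyumaya := presented juyumaya_rel.

HB.instance Definition _ := GRing.PzRing.on juyumaya.
HB.instance Definition _ := GRing.Lmodule.on juyumaya.

Definition juyumaya_T (i : 'I_n.-1) : juyumaya := pclass _ 'T_i.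
Definition juyumaya_E (i : 'I_n.-1) : juyumaya := pclass _ 'E_i.

(* The trivial representation, sending every T_i and E_i to 1. *)
Definition juyumaya_triv : juyumaya -> A^o :=
  @presented_lift _ _ juyumaya_rel A^o (fun=> 1).

Lemma juyumaya_triv_rel s t : juyumaya_rel s t ->
  term_eval (fun=> 1 : A^o) s = term_eval (fun=> 1 : A^o) t.
Proof. by case=> * //=; rewrite ?mulr1 // subrr mulr0 scaler0 addr0. Qed.

Lemma juyumaya_trivE s :
  juyumaya_triv (pclass _ s) = term_eval (fun=> 1 : A^o) s.
Proof. exact: presented_liftE juyumaya_triv_rel s. Qed.

Lemma juyumaya_trivD : {morph juyumaya_triv : x y / x + y}.
Proof.
move=> x y; case: (prepr x) (prepr y) => s -> [t ->].
by rewrite [X in juyumaya_triv X]paddE !juyumaya_trivE.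
Qed.
Lemma juyumaya_trivM : {morph juyumaya_triv : x y / x * y}.
Proof.
move=> x y; case: (prepr x) (prepr y) => s -> [t ->].
by rewrite [X in juyumaya_triv X]pmulE !juyumaya_trivE.
Qed.
Lemma juyumaya_trivZ a : {morph juyumaya_triv : x / a *: x}.
Proof.
move=> x; case: (prepr x) => s ->.
by rewrite [X in juyumaya_triv X]pscaleE !juyumaya_trivE.
Qed.
Lemma juyumaya_triv1 : juyumaya_triv 1 = 1.
Proof. by rewrite [LHS]juyumaya_trivE. Qed.
Lemma juyumaya_triv0 : juyumaya_triv 0 = 0.
Proof. by rewrite [LHS]juyumaya_trivE. Qed.

Lemma juyumaya_neq0 : 1 != 0 :> juyumaya.
Proof.
apply/eqP => /(congr1 juyumaya_triv)/eqP.
by rewrite juyumaya_triv1 juyumaya_triv0 oner_eq0.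
Qed.

HB.instance Definition _ :=
  GRing.PzSemiRing_isNonZero.Build juyumaya juyumaya_neq0.
HB.instance Definition _ :=
  GRing.Lmodule_isLalgebra.Build A juyumaya (@pscaleAl _ _ juyumaya_rel).
HB.instance Definition _ :=
  GRing.Lalgebra_isAlgebra.Build A juyumaya (@pscaleAr _ _ juyumaya_rel).

End JuyumayaPresentation.

(* The ring F[u, u^-1] of Laurent polynomials, as the subring of F(u) of the  *)
(* elements p / u ^ k for p in F[u] and k in nat.                             *)

Section Laurent.
Variable F : fieldType.

Local Notation FX := {fraction {poly F}}.
Local Notation tf := (@tofrac {poly F}).

Definition is_laurent : pred FX := fun z =>
  `[< exists (p : {poly F}) (k : nat), z = tf p / tf 'X ^+ k >].

Lemma is_laurentP z :
  reflect (exists (p : {poly F}) (k : nat), z = tf p / tf 'X ^+ k)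
          (is_laurent z).
Proof. exact: asboolP. Qed.

Lemma tfX_neq0 : tf 'X != 0.
Proof. by rewrite tofrac_eq0 polyX_eq0. Qed.
Lemma tfXn_neq0 k : tf 'X ^+ k != 0.
Proof. by rewrite expf_neq0 ?tfX_neq0. Qed.

Lemma subf_div (K : fieldType) (a b c d : K) :
  c != 0 -> d != 0 -> a / c - b / d = (a * d - b * c) / (c * d).
Proof. by move=> c0 d0; rewrite -mulNr addf_div // mulNr. Qed.

Lemma is_laurent_subring : subring_closed is_laurent.
Proof.
split=> [|_ _ /is_laurentP[p [k ->]] /is_laurentP[q [l ->]]
         |_ _ /is_laurentP[p [k ->]] /is_laurentP[q [l ->]]]; apply/is_laurentP.
- by exists 1, 0%N; rewrite expr0 divr1 rmorph1.
- exists (p * 'X^l - q * 'X^k), (k + l)%N.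
  by rewrite subf_div ?tfXn_neq0// rmorphB !rmorphM !rmorphXn /= exprD.
- by exists (p * q), (k + l)%N; rewrite rmorphM /= exprD mulf_div.
Qed.

HB.instance Definition _ :=
  GRing.isSubringClosed.Build FX is_laurent is_laurent_subring.

Record laurent := Laurent { laurent_val : FX; _ : is_laurent laurent_val }.

HB.instance Definition _ := [isSub for laurent_val].
HB.instance Definition _ := [Choice of laurent by <:].
HB.instance Definition _ := [SubChoice_isSubComNzRing of laurent by <:].

Lemma laurentX_subproof : is_laurent (tf 'X).
Proof. by apply/is_laurentP; exists 'X, 0%N; rewrite expr0 divr1. Qed.

Definition laurentX : laurent := Laurent laurentX_subproof.

Lemma laurent_repr_subproof (z : laurent) :
  exists pk : {poly F} * nat, laurent_val z = tf pk.1 / tf 'X ^+ pk.2.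
Proof. by case: z => z /= /is_laurentP[p [k ->]]; exists (p, k). Qed.

Definition laurent_repr (z : laurent) : {poly F} * nat :=
  projT1 (cid (laurent_repr_subproof z)).

Lemma laurent_reprE z :
  laurent_val z = tf (laurent_repr z).1 / tf 'X ^+ (laurent_repr z).2.
Proof. by rewrite /laurent_repr; case: cid. Qed.

(* Evaluation at x; the nonzero hypothesis is an argument so that the ring    *)
(* morphism structure below applies.                                          *)
Definition laurent_eval (x : F) (_ : x != 0) (z : laurent) : F :=
  (laurent_repr z).1.[x] / x ^+ (laurent_repr z).2.

Variables (x : F) (x_neq0 : x != 0).
Local Notation ev := (laurent_eval x_neq0).

Lemma laurent_evalE z p k :
  laurent_val z = tf p / tf 'X ^+ k -> ev z = p.[x] / x ^+ k.
Proof.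
rewrite laurent_reprE /laurent_eval; case: (laurent_repr z) => q l /= /eqP.
rewrite eqr_div ?tfXn_neq0// -!rmorphXn -!rmorphM /= tofrac_eq => /eqP e.
apply/eqP; rewrite eqr_div ?expf_neq0//.
by have /(congr1 (horner^~ x)) := e; rewrite !hornerM !hornerXn => ->.
Qed.

Lemma laurent_evalX : ev laurentX = x.
Proof.
by rewrite (@laurent_evalE _ 'X 0%N) ?expr0 ?divr1 ?hornerX.
Qed.

Lemma laurent_eval_is_zmod_morphism : zmod_morphism ev.
Proof.
move=> a b; rewrite {2 3}/laurent_eval.
move: (laurent_reprE a) (laurent_reprE b).
case: (laurent_repr a) (laurent_repr b) => p k [q l] /= ea eb.
rewrite (@laurent_evalE _ (p * 'X^l - q * 'X^k) (k + l)%N).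
  by rewrite !hornerE exprD subf_div ?expf_neq0.
rewrite [LHS](rmorphB (val : laurent -> FX)) /= ea eb rmorphB !rmorphM !rmorphXn /= exprD.
by rewrite subf_div ?tfXn_neq0.
Qed.

Lemma laurent_eval_is_monoid_morphism : monoid_morphism ev.
Proof.
split=> [|a b].
  rewrite (@laurent_evalE _ 1 0%N); first by rewrite expr0 divr1 hornerE.
  by rewrite expr0 divr1 [LHS](rmorph1 (val : laurent -> FX)) rmorph1.
rewrite {2 3}/laurent_eval; move: (laurent_reprE a) (laurent_reprE b).
case: (laurent_repr a) (laurent_repr b) => p k [q l] /= ea eb.
rewrite (@laurent_evalE _ (p * q) (k + l)%N).
  by rewrite hornerM exprD mulf_div.
by rewrite [LHS](rmorphM (val : laurent -> FX)) /= ea eb rmorphM /= exprD mulf_div.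
Qed.

HB.instance Definition _ :=
  GRing.isZmodMorphism.Build laurent F ev laurent_eval_is_zmod_morphism.
HB.instance Definition _ :=
  GRing.isMonoidMorphism.Build laurent F ev laurent_eval_is_monoid_morphism.

End Laurent.

(* Extension of scalars E (x)_A K of an A-algebra E along f : A -> K. The     *)
(* sequence [:: (e_1, c_1); ...; (e_m, c_m)] stands for the sum of the        *)
(* e_k (x) c_k, and the congruence is generated by biadditivity and by        *)
(* (a e) (x) c = e (x) (f a c).                                               *)

Section BaseChange.
Variables (A K : comNzRingType) (f : {rmorphism A -> K}) (E : algType A).

Implicit Types (s t w : seq (E * K)).

Inductive tens_congr : seq (E * K) -> seq (E * K) -> Prop :=
  | tc_refl s : tens_congr s s
  | tc_sym s t : tens_congr s t -> tens_congr t s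
  | tc_trans s t w : tens_congr s t -> tens_congr t w -> tens_congr s w
  | tc_cat s s' t t' :
      tens_congr s s' -> tens_congr t t' -> tens_congr (s ++ t) (s' ++ t')
  | tc_catC s t : tens_congr (s ++ t) (t ++ s)
  | tc_addl e e' c : tens_congr [:: (e + e', c)] [:: (e, c); (e', c)]
  | tc_addr e c c' : tens_congr [:: (e, c + c')] [:: (e, c); (e, c')]
  | tc_zerol c : tens_congr [:: (0, c)] [::]
  | tc_zeror e : tens_congr [:: (e, 0)] [::]
  | tc_scale a e c : tens_congr [:: (a *: e, c)] [:: (e, f a * c)].

Definition tens_congrb : rel (seq (E * K)) := fun s t => `[< tens_congr s t >].

Lemma tens_congrb_refl : reflexive tens_congrb.
Proof. by move=> s; apply/asboolP; apply: tc_refl. Qed.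

Lemma tens_congrb_sym : symmetric tens_congrb.
Proof. by move=> s t; apply/asboolP/asboolP; apply: tc_sym. Qed.

Lemma tens_congrb_trans : transitive tens_congrb.
Proof.
by move=> t s w /asboolP st /asboolP tw; apply/asboolP; apply: tc_trans st tw.
Qed.

Canonical tens_congr_equiv :=
  EquivRel tens_congrb tens_congrb_refl tens_congrb_sym tens_congrb_trans.

Definition base_change := {eq_quot tens_congr_equiv}.

HB.instance Definition _ := Choice.on base_change.
HB.instance Definition _ := EqQuotient.on base_change.

Definition tclass s : base_change := \pi_base_change s.

Lemma tclassP s t : tclass s = tclass t <-> tens_congr s t.
Proof. by split=> [/eqmodP/asboolP|st] //; apply/eqmodP/asboolP. Qed.

Lemma trepr (x : base_change) : {s | x = tclass s}.
Proof. by exists (repr x); rewrite /tclass reprK. Qed.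

Lemma repr_tclass s : tens_congr (repr (tclass s)) s.
Proof. by apply/tclassP; rewrite /tclass reprK. Qed.

Lemma tc_perm s t : perm_eq s t -> tens_congr s t.
Proof.
move=> st; apply: (catCA_perm_ind (P := tens_congr s) _ st (tc_refl s)).
move=> s1 s2 s3 H; apply: tc_trans H _; rewrite !catA.
by apply: tc_cat (tc_refl _); apply: tc_catC.
Qed.

Definition seq_opp s : seq (E * K) := [seq (- x.1, x.2) | x <- s].
Definition seq_mul s t : seq (E * K) :=
  [seq (x.1 * y.1, x.2 * y.2) | x <- s, y <- t].
Definition seq_scale c s : seq (E * K) := [seq (x.1, c * x.2) | x <- s].

Lemma tc_map (phi : E -> E) (psi : K -> K) :
    (forall x y, phi (x + y) = phi x + phi y) -> phi 0 = 0 ->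
    (forall a x, phi (a *: x) = a *: phi x) ->
    (forall x y, psi (x + y) = psi x + psi y) -> psi 0 = 0 ->
    (forall a c, psi (f a * c) = f a * psi c) ->
  forall s t, tens_congr s t ->
  tens_congr [seq (phi x.1, psi x.2) | x <- s]
             [seq (phi x.1, psi x.2) | x <- t].
Proof.
move=> phiD phi0 phiZ psiD psi0 psiZ s t; elim=> {s t} /=.
- by move=> s; apply: tc_refl.
- by move=> s t _; apply: tc_sym.
- by move=> s t w _ st _; apply: tc_trans st.
- by move=> s s' t t' _ ss' _ tt'; rewrite !map_cat; apply: tc_cat.
- by move=> s t; rewrite !map_cat; apply: tc_catC.
- by move=> *; rewrite phiD; apply: tc_addl.
- by move=> *; rewrite psiD; apply: tc_addr.
- by move=> *; rewrite phi0; apply: tc_zerol.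
- by move=> *; rewrite psi0; apply: tc_zeror.
- by move=> *; rewrite phiZ psiZ; apply: tc_scale.
Qed.

Lemma tc_opp s t : tens_congr s t -> tens_congr (seq_opp s) (seq_opp t).
Proof.
by apply: (tc_map (phi := -%R) (psi := id)); rewrite ?oppr0 // => *;
  rewrite ?opprD ?scalerN.
Qed.

Lemma tc_scaler c s t :
  tens_congr s t -> tens_congr (seq_scale c s) (seq_scale c t).
Proof.
by apply: (tc_map (phi := id) (psi := *%R c)); rewrite ?mulr0 // => *;
  rewrite ?mulrDr // mulrCA.
Qed.

Lemma seq_mul_cons x s t :
  seq_mul (x :: s) t = [seq (x.1 * y.1, x.2 * y.2) | y <- t] ++ seq_mul s t.
Proof. by []. Qed.

Lemma seq_mul1s x t :
  seq_mul [:: x] t = [seq (x.1 * y.1, x.2 * y.2) | y <- t].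
Proof. by rewrite seq_mul_cons cats0. Qed.

Lemma seq_mul_catl s s' t : seq_mul (s ++ s') t = seq_mul s t ++ seq_mul s' t.
Proof. by rewrite /seq_mul allpairs_cat. Qed.

Lemma seq_mul_catr s t t' :
  tens_congr (seq_mul s (t ++ t')) (seq_mul s t ++ seq_mul s t').
Proof.
by apply: tc_perm; apply/permPl/perm_allpairs_catr.
Qed.

Lemma tc_mulr s t t' :
  tens_congr t t' -> tens_congr (seq_mul s t) (seq_mul s t').
Proof.
move=> tt'; elim: s => [|x s IHs]; first exact: tc_refl.
rewrite !seq_mul_cons; apply: tc_cat IHs.
apply: (tc_map (phi := fun e => x.1 * e) (psi := fun c => x.2 * c)) tt';
  rewrite ?mulr0 // => *; rewrite ?mulrDr ?scalerAr //.
by rewrite mulrCA.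
Qed.

Lemma seq_muls1 s y :
  seq_mul s [:: y] = [seq (x.1 * y.1, x.2 * y.2) | x <- s].
Proof. by rewrite /seq_mul allpairs1r. Qed.

Lemma tc_mull s s' t :
  tens_congr s s' -> tens_congr (seq_mul s t) (seq_mul s' t).
Proof.
move=> ss'; elim: t => [|y t IHt].
  by rewrite /seq_mul !allpairs0r; apply: tc_refl.
have cons1 r : tens_congr (seq_mul r (y :: t)) (seq_mul r [:: y] ++ seq_mul r t).
  exact: seq_mul_catr r [:: y] t.
apply: tc_trans (cons1 s) _; apply: tc_trans (tc_sym (cons1 s')).
apply: tc_cat IHt; rewrite !seq_muls1.
apply: (tc_map (phi := fun e => e * y.1) (psi := fun c => c * y.2)) ss';
  rewrite ?mul0r // => *; rewrite ?mulrDl ?scalerAl //.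
by rewrite mulrA.
Qed.

Definition tadd (x y : base_change) := tclass (repr x ++ repr y).
Definition topp (x : base_change) := tclass (seq_opp (repr x)).
Definition tmul (x y : base_change) := tclass (seq_mul (repr x) (repr y)).
Definition tscale c (x : base_change) := tclass (seq_scale c (repr x)).

Lemma taddE s t : tadd (tclass s) (tclass t) = tclass (s ++ t).
Proof. by apply/tclassP; apply: tc_cat; apply: repr_tclass. Qed.
Lemma toppE s : topp (tclass s) = tclass (seq_opp s).
Proof. by apply/tclassP; apply: tc_opp; apply: repr_tclass. Qed.
Lemma tmulE s t : tmul (tclass s) (tclass t) = tclass (seq_mul s t).
Proof.
apply/tclassP; apply: tc_trans (tc_mull _ (repr_tclass s)) _.
by apply: tc_mulr; apply: repr_tclass.
Qed.
Lemma tscaleE c s : tscale c (tclass s) = tclass (seq_scale c s).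
Proof. by apply/tclassP; apply: tc_scaler; apply: repr_tclass. Qed.
Definition tE := (taddE, toppE, tmulE, tscaleE).

Lemma taddA : associative tadd.
Proof.
move=> x y z; case: (trepr x) (trepr y) (trepr z) => s -> [t ->] [w ->].
by rewrite !tE catA.
Qed.
Lemma taddC : commutative tadd.
Proof.
move=> x y; case: (trepr x) (trepr y) => s -> [t ->].
by rewrite !tE; apply/tclassP; apply: tc_catC.
Qed.
Lemma tadd0 : left_id (tclass [::]) tadd.
Proof. by move=> x; case: (trepr x) => s ->; rewrite !tE. Qed.
Lemma taddN : left_inverse (tclass [::]) topp tadd.
Proof.
move=> x; case: (trepr x) => s ->; rewrite !tE; apply/tclassP.
elim: s => [|[e c] s IHs] /=; first exact: tc_refl.
apply: (@tc_trans _ ([:: (- e, c); (e, c)] ++ (seq_opp s ++ s))).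
  apply: tc_perm; rewrite perm_cons -[(e, c) :: s]cat1s perm_catCA.
  by rewrite /= perm_refl.
rewrite -[[::]]cats0; apply: tc_cat IHs.
apply: tc_trans (tc_sym (tc_addl _ _ _)) _.
by rewrite addNr; apply: tc_zerol.
Qed.

HB.instance Definition _ :=
  GRing.isZmodule.Build base_change taddA taddC tadd0 taddN.

Lemma tmulA : associative tmul.
Proof.
move=> x y z; case: (trepr x) (trepr y) (trepr z) => s -> [t ->] [w ->].
rewrite !tE; congr tclass; elim: s => [|a s IHs] //.
rewrite !seq_mul_cons seq_mul_catl IHs; congr (_ ++ _).
elim: t {IHs} => [|b t IHt] //; rewrite !seq_mul_cons map_cat IHt; congr (_ ++ _).
by rewrite -map_comp; apply: eq_map => d /=; rewrite !mulrA.
Qed.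
Lemma tmul1l : left_id (tclass [:: (1, 1)]) tmul.
Proof.
move=> x; case: (trepr x) => s ->; rewrite !tE seq_mul1s; congr tclass.
by rewrite -[RHS]map_id; apply: eq_map => -[e c] /=; rewrite !mul1r.
Qed.
Lemma tmul1r : right_id (tclass [:: (1, 1)]) tmul.
Proof.
move=> x; case: (trepr x) => s ->; rewrite !tE seq_muls1; congr tclass.
by rewrite -[RHS]map_id; apply: eq_map => -[e c] /=; rewrite !mulr1.
Qed.
Lemma tmulDl : left_distributive tmul (@GRing.add base_change).
Proof.
move=> x y z; case: (trepr x) (trepr y) (trepr z) => s -> [t ->] [w ->].
by rewrite /GRing.add /= !tE seq_mul_catl.
Qed.
Lemma tmulDr : right_distributive tmul (@GRing.add base_change).
Proof.
move=> x y z; case: (trepr x) (trepr y) (trepr z) => s -> [t ->] [w ->].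
by rewrite /GRing.add /= !tE; apply/tclassP; apply: seq_mul_catr.
Qed.

HB.instance Definition _ :=
  GRing.Zmodule_isPzRing.Build base_change tmulA tmul1l tmul1r tmulDl tmulDr.

Lemma tscaleA a b x : tscale a (tscale b x) = tscale (a * b) x.
Proof.
case: (trepr x) => s ->; rewrite !tE /seq_scale -map_comp; congr tclass.
by apply: eq_map => y /=; rewrite mulrA.
Qed.
Lemma tscale1 : left_id 1 tscale.
Proof.
move=> x; case: (trepr x) => s ->; rewrite !tE; congr tclass.
by rewrite -[RHS]map_id; apply: eq_map => -[e c] /=; rewrite !mul1r.
Qed.
Lemma tscaleDr : right_distributive tscale (@GRing.add base_change).
Proof.
move=> a x y; case: (trepr x) (trepr y) => s -> [t ->].
by rewrite /GRing.add /= !tE /seq_scale map_cat.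
Qed.
Lemma tscaleDl x : {morph tscale^~ x : a b / a + b}.
Proof.
move=> a b; case: (trepr x) => s ->.
rewrite {2}/GRing.add /= !tE; apply/tclassP.
elim: s => [|[e c] s IHs] /=; first exact: tc_refl.
rewrite mulrDl.
apply: (@tc_trans _ ([:: (e, a * c); (e, b * c)]
                     ++ (seq_scale a s ++ seq_scale b s))).
  by rewrite -cat1s; apply: tc_cat IHs; apply: tc_addr.
apply: tc_perm; rewrite /= perm_cons.
rewrite -[(_, b * c) :: (seq_scale a s ++ _)]cat1s.
by rewrite -[(_, b * c) :: map _ _]cat1s perm_catCA.
Qed.

HB.instance Definition _ := GRing.Zmodule_isLmodule.Build K base_change
  tscaleA tscale1 tscaleDr tscaleDl.

Lemma tscaleAl (a : K) (x y : base_change) : a *: (x * y) = a *: x * y.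
Proof.
case: (trepr x) (trepr y) => s -> [t ->].
rewrite /GRing.scale /GRing.mul /= !tE; congr tclass.
elim: s => [|x1 s IHs] //=; rewrite !seq_mul_cons /seq_scale map_cat.
rewrite -map_comp; congr (_ ++ _) => //.
by apply: eq_map => z /=; rewrite mulrA.
Qed.
Lemma tscaleAr (a : K) (x y : base_change) : a *: (x * y) = x * (a *: y).
Proof.
case: (trepr x) (trepr y) => s -> [t ->].
rewrite /GRing.scale /GRing.mul /= !tE; congr tclass.
elim: s => [|x1 s IHs] //=; rewrite !seq_mul_cons /seq_scale map_cat.
rewrite -!map_comp; congr (_ ++ _) => //.
by apply: eq_map => z /=; rewrite mulrCA.
Qed.

Definition tens (e : E) (c : K) : base_change := tclass [:: (e, c)].

(* An A-linear form on E sending 1 to 1 shows that the base change is         *)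
(* nontrivial.                                                                *)
Lemma base_change_neq0 (eps : E -> A) :
    (forall x y, eps (x + y) = eps x + eps y) -> eps 0 = 0 ->
    (forall a x, eps (a *: x) = a * eps x) -> eps 1 = 1 ->
  1 != 0 :> base_change.
Proof.
move=> epsD eps0 epsZ eps1; apply/eqP => /tclassP H.
pose ev s := \sum_(x <- s) f (eps x.1) * x.2.
suff tc_ev s t : tens_congr s t -> ev s = ev t.
  move/tc_ev: H; rewrite /ev big_nil big_seq1 /= eps1 rmorph1 mulr1.
  by move/eqP; rewrite oner_eq0.
rewrite /ev; elim=> {s t} //.
- by move=> s t w _ -> _ ->.
- by move=> s s' t t' _ ss' _ tt'; rewrite !big_cat /= ss' tt'.
- by move=> s t; rewrite !big_cat /= addrC.
- by move=> *; rewrite !big_cons !big_nil /= !addr0 epsD rmorphD mulrDl.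
- by move=> *; rewrite !big_cons !big_nil /= !addr0 mulrDr.
- by move=> *; rewrite big_nil big_seq1 /= eps0 rmorph0 mul0r.
- by move=> *; rewrite big_nil big_seq1 /= mulr0.
- by move=> *; rewrite !big_seq1 /= epsZ rmorphM mulrA [f _ * f _]mulrC.
Qed.

End BaseChange.

Section JuyumayaAt.
Variables (F : fieldType) (x : F) (x_neq0 : x != 0) (n : nat).

Local Notation JA := (juyumaya (laurentX F) n).

Definition juyumaya_at := base_change (laurent_eval x_neq0) JA.

HB.instance Definition _ := GRing.PzRing.on juyumaya_at.
HB.instance Definition _ := GRing.Lmodule.on juyumaya_at.

Lemma juyumaya_at_neq0 : 1 != 0 :> juyumaya_at.
Proof.
apply: (@base_change_neq0 _ _ _ JA (@juyumaya_triv _ (laurentX F) n)).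
- exact: juyumaya_trivD.
- exact: juyumaya_triv0.
- exact: juyumaya_trivZ.
- exact: juyumaya_triv1.
Qed.

HB.instance Definition _ :=
  GRing.PzSemiRing_isNonZero.Build juyumaya_at juyumaya_at_neq0.
HB.instance Definition _ := GRing.Lmodule_isLalgebra.Build F juyumaya_at
  (@tscaleAl _ _ (laurent_eval x_neq0) JA).
HB.instance Definition _ := GRing.Lalgebra_isAlgebra.Build F juyumaya_at
  (@tscaleAr _ _ (laurent_eval x_neq0) JA).

Definition gen_T (i : 'I_n.-1) : juyumaya_at :=
  tens (laurent_eval x_neq0) (juyumaya_T (laurentX F) i) 1.
Definition gen_E (i : 'I_n.-1) : juyumaya_at :=
  tens (laurent_eval x_neq0) (juyumaya_E (laurentX F) i) 1.

End JuyumayaAt.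

(* Set partitions of {1, ..., n} u {1', ..., n'}; the vertex i is inl i and   *)
(* the vertex i' is inr i.                                                    *)

Definition vertex n : finType := ('I_n + 'I_n)%type.

Record diagram n := Diagram {
  parts : {set {set vertex n}};
  _ : partition parts [set: vertex n]
}.

HB.instance Definition _ n := [isSub for @parts n].
HB.instance Definition _ n := [Finite of diagram n by <:].

Section Diagrams.
Variable n : nat.
Implicit Types (p q r : diagram n) (x y z : vertex n).

Definition same_part p : rel (vertex n) := fun x y => y \in pblock (parts p) x.

Lemma same_partE p x y B : B \in parts p -> x \in B -> same_part p x y = (y \in B).
Proof.
move=> Bp xB; rewrite /same_part (def_pblock _ Bp xB) //.
by have /and3P[] := valP p.
Qed.

Lemma mem_part p x : exists2 B, B \in parts p & x \in B.
Proof.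
have /and3P[/eqP covp _ _] := valP p.
have : x \in cover (parts p) by rewrite covp inE.
by move=> /bigcupP[B Bp xB]; exists B.
Qed.

Lemma same_part_refl p : reflexive (same_part p).
Proof. by move=> x; have [B Bp xB] := mem_part p x; rewrite (same_partE _ Bp). Qed.

Lemma same_part_sym p : symmetric (same_part p).
Proof.
suff H x y : same_part p x y -> same_part p y x.
  by move=> x y; apply/idP/idP; apply: H.
have [B Bp xB] := mem_part p x.
by rewrite (same_partE _ Bp xB) => yB; rewrite (same_partE _ Bp yB).
Qed.

Lemma same_part_trans p : transitive (same_part p).
Proof.
move=> y x z; have [B Bp yB] := mem_part p y.
by rewrite same_part_sym !(same_partE _ Bp yB) => /(same_partE _ Bp) ->.
Qed.

Lemma diagram_ext p q : same_part p =2 same_part q -> p = q.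
Proof.
move=> pq; apply: val_inj.
rewrite -(equivalence_partition_pblock (valP p)).
rewrite -(equivalence_partition_pblock (valP q)).
rewrite /equivalence_partition; apply: eq_imset => x.
by apply/setP => y; rewrite !inE; apply: pq.
Qed.

Lemma is_partitionP (P : {set {set vertex n}}) :
    (forall B, B \in P -> exists x, x \in B) ->
    (forall x, exists2 B, B \in P & x \in B) ->
    (forall B C x, B \in P -> C \in P -> x \in B -> x \in C -> B = C) ->
  partition P [set: vertex n].
Proof.
move=> P0 Pcov Pinj; apply/and3P; split.
- apply/eqP/setP => x; rewrite inE; apply/bigcupP.
  by have [B BP xB] := Pcov x; exists B.
- apply/trivIsetP => B C BP CP; apply: contraNT => /pred0Pn[x /andP[xB xC]].
  exact/eqP/(Pinj _ _ _ BP CP xB xC).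
- by apply/negP => /P0[x]; rewrite inE.
Qed.

Section OfRelation.
Variables (R : rel (vertex n)) (R_equiv : equivalence_rel R).

Lemma rel_diagram_subproof :
  partition (equivalence_partition R [set: vertex n]) [set: vertex n].
Proof. by apply: equivalence_partitionP => x y z _ _ _; apply: R_equiv. Qed.

Definition rel_diagram : diagram n := Diagram rel_diagram_subproof.

Lemma same_part_rel : same_part rel_diagram =2 R.
Proof.
by move=> x y; rewrite /same_part /= pblock_equivalence_partition ?inE.
Qed.

End OfRelation.

(* Stacking p on top of q: the left summand is the diagram p, whose bottom    *)
(* vertices are the middle ones, and the right summand is the bottom of q.    *)
Definition stack : finType := (('I_n + 'I_n) + 'I_n)%type.
Definition top_vertex (i : 'I_n) : stack := inl (inl i).
Definition middle_vertex (i : 'I_n) : stack := inl (inr i).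
Definition bottom_vertex (i : 'I_n) : stack := inr i.

Definition upper x : stack :=
  match x with inl i => top_vertex i | inr i => middle_vertex i end.
Definition lower x : stack :=
  match x with inl i => middle_vertex i | inr i => bottom_vertex i end.
Definition outer x : stack :=
  match x with inl i => top_vertex i | inr i => bottom_vertex i end.

Definition stack_edge p q : rel stack := fun v w =>
  [exists x, exists y, [&& v == upper x, w == upper y & same_part p x y]]
  || [exists x, exists y, [&& v == lower x, w == lower y & same_part q x y]].

Definition stack_connect p q : rel (vertex n) := fun x y =>
  connect (stack_edge p q) (outer x) (outer y).

Lemma stack_edge_sym p q : symmetric (stack_edge p q).
Proof.
suff H v w : stack_edge p q v w -> stack_edge p q w v.
  by move=> v w; apply/idP/idP; apply: H.
move=> /orP[] /existsP[x /existsP[y /and3P[vx wy xy]]]; apply/orP;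
  [left|right]; apply/existsP; exists y; apply/existsP; exists x;
  by rewrite vx wy same_part_sym.
Qed.

Lemma stack_connect_equiv p q : equivalence_rel (stack_connect p q).
Proof.
have csym : connect_sym (stack_edge p q) by apply/sym_connect_sym/stack_edge_sym.
move=> x y z; split; first exact: connect0.
by move=> xy; rewrite /stack_connect; apply: (same_connect csym xy).
Qed.

Definition dcomp p q : diagram n := rel_diagram (stack_connect_equiv p q).

Lemma one_diagram_subproof :
  partition [set ([set inl k; inr k] : {set vertex n}) | k : 'I_n]
            [set: vertex n].
Proof.
apply: is_partitionP => [B /imsetP[k _ ->]|x|B C x /imsetP[k _ ->]].
- by exists (inl k); rewrite !inE eqxx.
- exists [set inl (match x with inl k | inr k => k end);
          inr (match x with inl k | inr k => k end)].
    exact: imset_f.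
  by case: x => k; rewrite !inE eqxx ?orbT.
- by move=> /imsetP[l _ ->]; case: x => m; rewrite !inE /= ?orbF;
    move=> /eqP[->] /eqP[->].
Qed.

Definition one_diagram : diagram n := Diagram one_diagram_subproof.

Section TwoIndices.
Variables i j : 'I_n.

Definition straight_parts : {set {set vertex n}} :=
  [set [set inl k; inr k] | k in ~: [set i; j]].

Lemma transposition_subproof :
  partition ([set [set inl i; inr j]; [set inl j; inr i]] :|: straight_parts)
            [set: vertex n].
Proof.
pose cl (x : vertex n) : {set vertex n} :=
  [set y | match y with inl k => k | inr k => tperm i j k end
           == match x with inl k => k | inr k => tperm i j k end].
have clP B : B \in [set [set inl i; inr j]; [set inl j; inr i]]
                 :|: straight_parts ->
             forall x, x \in B -> B = cl x.
  rewrite !inE => /orP[/orP[]/eqP->|/imsetP[k + ->]].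
  - by move=> x; rewrite !inE => /orP[]/eqP-> ; apply/setP => -[m|m];
      rewrite !inE /= ?orbF ?tpermR // -(inj_eq (@perm_inj _ (tperm i j)))
        ?tpermK ?tpermL ?tpermR.
  - by move=> x; rewrite !inE => /orP[]/eqP-> ; apply/setP => -[m|m];
      rewrite !inE /= ?orbF ?tpermL // -(inj_eq (@perm_inj _ (tperm i j)))
        ?tpermK ?tpermL ?tpermR.
  - rewrite !inE negb_or => /andP[ki kj].
    have kE : tperm i j k = k by rewrite tpermD // eq_sym.
    by move=> x; rewrite !inE => /orP[]/eqP-> ; apply/setP => -[m|m];
      rewrite !inE /= ?orbF ?kE // -(inj_eq (@perm_inj _ (tperm i j)))
        ?tpermK ?kE.
apply: is_partitionP => [B|x|B C x BP CP xB xC]; last first.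
- by rewrite (clP _ BP _ xB) (clP _ CP _ xC).
- have [->|ni] := eqVneq x (inl i).
    by exists [set inl i; inr j]; rewrite !inE eqxx.
  have [->|nj] := eqVneq x (inl j).
    by exists [set inl j; inr i]; rewrite !inE eqxx ?orbT.
  have [->|ni'] := eqVneq x (inr i).
    by exists [set inl j; inr i]; rewrite !inE eqxx ?orbT.
  have [->|nj'] := eqVneq x (inr j).
    by exists [set inl i; inr j]; rewrite !inE eqxx ?orbT.
  case: x ni nj ni' nj' => k ni nj ni' nj'.
    exists [set inl k; inr k]; last by rewrite !inE eqxx.
    rewrite inE; apply/orP; right; apply: imset_f; rewrite !inE negb_or.
    by rewrite ni nj.
  exists [set inl k; inr k]; last by rewrite !inE eqxx orbT.
  rewrite inE; apply/orP; right; apply: imset_f; rewrite !inE negb_or.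
  by rewrite ni' nj'.
- rewrite !inE => /orP[/orP[]/eqP->|/imsetP[k _ ->]].
  + by exists (inl i); rewrite !inE eqxx.
  + by exists (inl j); rewrite !inE eqxx.
  + by exists (inl k); rewrite !inE eqxx.
Qed.

Definition transposition : diagram n := Diagram transposition_subproof.

Lemma joined_subproof :
  partition ([set inl i; inr i; inl j; inr j] |: straight_parts)
            [set: vertex n].
Proof.
apply: is_partitionP => [B|x|B C x].
- by rewrite !inE => /orP[/eqP->|/imsetP[k _ ->]];
    [exists (inl i)|exists (inl k)]; rewrite !inE eqxx.
- pose k := match x with inl k | inr k => k end.
  have [kij|kij] := boolP (k \in [set i; j]).
    exists [set inl i; inr i; inl j; inr j]; first by rewrite !inE eqxx.
    move: kij; rewrite {}/k !inE => /orP[]/eqP; case: x => k -> ;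
      by rewrite eqxx ?orbT.
  exists [set inl k; inr k].
    by rewrite !inE; apply/orP; right; apply: imset_f; rewrite inE.
  by rewrite {}/k in kij *; case: x kij => k _; rewrite !inE eqxx ?orbT.
- have aux k : k \in ~: [set i; j] -> forall x : vertex n,
      x \in [set inl k; inr k] -> x \in [set inl i; inr i; inl j; inr j] ->
      False.
    rewrite !inE negb_or => /andP[/negbTE ki /negbTE kj] y.
    by rewrite !inE => /orP[]/eqP->; rewrite /eq_op /= ki kj.
  rewrite !inE => /orP[/eqP->|/imsetP[k kij ->]] /orP[/eqP->|/imsetP[l lij ->]] //.
  + by move=> xB xC; case: (aux _ lij _ xC xB).
  + by move=> xB xC; case: (aux _ kij _ xB xC).
  + by case: x => m; rewrite !inE /= ?orbF; move=> /eqP[->] /eqP[->].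
Qed.

(* The partition A^{i,j}. *)
Definition joined : diagram n := Diagram joined_subproof.

End TwoIndices.

(* S_n, as the partitions all of whose parts are of the form {i, j'}. *)
Definition sym_diagrams : {set diagram n} :=
  [set p | [forall B in parts p, exists i, exists j, B == [set inl i; inr j]]].

Definition diag_diagrams : {set diagram n} :=
  [set p | [forall i, same_part p (inl i) (inr i)]].

Definition ltimes (ab : diagram n * diagram n) : diagram n * diagram n :=
  (ab.1, dcomp ab.2 ab.1).

Definition ltimes_image : {set diagram n * diagram n} :=
  ltimes @: setX sym_diagrams diag_diagrams.

Record ltimes_basis := LtimesBasis {
  basis_val : diagram n * diagram n;
  _ : basis_val \in ltimes_image
}.

HB.instance Definition _ := [isSub for basis_val].
HB.instance Definition _ := [Finite of ltimes_basis by <:].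

(* Two-colourings of the vertices that are constant on the parts determine a  *)
(* partition, and they compose as relations; the monoid laws follow.          *)

Definition glue (f g : 'I_n -> bool) x := match x with inl i => f i | inr i => g i end.

Definition colouring p f g := forall x y, same_part p x y -> glue f g x = glue f g y.

Lemma same_partP p x y :
  same_part p x y <->
  (forall f g, colouring p f g -> glue f g x = glue f g y).
Proof.
split=> [xy f g /(_ _ _ xy)//|H].
pose c z := same_part p x z.
have gE z : glue (fun i => c (inl i)) (fun i => c (inr i)) z = c z by case: z.
have := H (fun i => c (inl i)) (fun i => c (inr i)).
rewrite !gE /c same_part_refl => <- // z w zw; rewrite !gE /c.
by apply/idP/idP => /same_part_trans; apply; rewrite // same_part_sym.
Qed.

Lemma colouring_inj p q :
  (forall f g, colouring p f g <-> colouring q f g) -> p = q.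
Proof.
move=> pq; apply: diagram_ext => x y; apply/idP/idP => /same_partP H;
  by apply/same_partP => f g /pq; apply: H.
Qed.

Lemma colouring_comp p q f h :
  colouring (dcomp p q) f h <-> exists g, colouring p f g /\ colouring q g h.
Proof.
split=> [pq|[g [pg qg]] x y]; last first.
  rewrite same_part_rel /stack_connect.
  pose C (v : stack) :=
    match v with inl (inl i) => f i | inl (inr i) => g i | inr i => h i end.
  have CE v w : stack_edge p q v w -> C v = C w.
    move=> /orP[] /existsP[a /existsP[b /and3P[/eqP-> /eqP->]]].
      by move=> /pg; case: a b => ? [].
    by move=> /qg; case: a b => ? [].
  have -> : glue f h x = C (outer x) by case: x.
  have -> : glue f h y = C (outer y) by case: y.
  move=> /connectP[s + ->]; elim: s (outer x) => //= w s IHs v.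
  by move=> /andP[/CE-> /IHs].
pose C v := [exists x, glue f h x && connect (stack_edge p q) (outer x) v].
have Cout x : C (outer x) = glue f h x.
  apply/existsP/idP => [[y /andP[hy yx]]|hx]; last first.
    by exists x; rewrite hx connect0.
  by rewrite -(pq y x) // same_part_rel.
have Cedge v w : stack_edge p q v w -> C v = C w.
  move=> vw; apply/existsP/existsP => -[x /andP[hx xv]]; exists x; rewrite hx /=.
    exact: connect_trans xv (connect1 vw).
  by apply: connect_trans xv (connect1 _); rewrite stack_edge_sym.
exists (fun i => C (middle_vertex i)); split=> x y xy.
  have E z : glue f (fun i => C (middle_vertex i)) z = C (upper z).
    by case: z => i //; apply: esym (Cout (inl i)).
  rewrite !E; apply: Cedge; apply/orP; left.
  by apply/existsP; exists x; apply/existsP; exists y; rewrite !eqxx.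
have E z : glue (fun i => C (middle_vertex i)) h z = C (lower z).
  by case: z => i //; apply: esym (Cout (inr i)).
rewrite !E; apply: Cedge; apply/orP; right.
by apply/existsP; exists x; apply/existsP; exists y; rewrite !eqxx.
Qed.

Lemma compA : associative dcomp.
Proof.
move=> p q r; apply: colouring_inj => f k; split.
  move=> /colouring_comp[g [pg /colouring_comp[h [qh rh]]]].
  by apply/colouring_comp; exists h; split=> //; apply/colouring_comp; exists g.
move=> /colouring_comp[h [/colouring_comp[g [pg qh]] rh]].
by apply/colouring_comp; exists g; split=> //; apply/colouring_comp; exists h.
Qed.

Lemma same_part_one (i j : 'I_n) : same_part one_diagram (inl i) (inr j) = (i == j).
Proof.
have iP : [set inl i; inr i] \in parts one_diagram by apply: imset_f.
by rewrite (same_partE _ iP) !inE ?eqxx //= eq_sym.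
Qed.

Lemma colouring_one f g : colouring one_diagram f g <-> f =1 g.
Proof.
split=> [fg i|fg x y].
  by apply: (fg (inl i) (inr i)); rewrite same_part_one.
have [B Bp xB] := mem_part one_diagram x; rewrite (same_partE _ Bp xB) => yB.
case/imsetP: Bp xB yB => k _ ->.
by rewrite !inE => /orP[]/eqP-> /orP[]/eqP-> /=; rewrite ?fg.
Qed.

Lemma comp1d : left_id one_diagram dcomp.
Proof.
move=> p; apply: colouring_inj => f h; split.
  by move=> /colouring_comp[g [/colouring_one/funext->]].
by move=> pf; apply/colouring_comp; exists f; split=> //; apply/colouring_one.
Qed.

Lemma compd1 : right_id one_diagram dcomp.
Proof.
move=> p; apply: colouring_inj => f h; split.
  by move=> /colouring_comp[g [pg /colouring_one/funext<-]].
by move=> pf; apply/colouring_comp; exists h; split=> //; apply/colouring_one.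
Qed.

Definition perm_key (s : 'S_n) x : 'I_n :=
  match x with inl i => s i | inr i => i end.

Lemma perm_key_equiv s :
  equivalence_rel [rel x y | perm_key s x == perm_key s y].
Proof. by move=> x y z; split=> //= /eqP->. Qed.

Definition perm_diagram s : diagram n := rel_diagram (perm_key_equiv s).

Lemma colouring_perm s f g : colouring (perm_diagram s) f g <-> f =1 g \o s.
Proof.
split=> [fg i|fg x y].
  by apply: (fg (inl i) (inr (s i))); rewrite same_part_rel /=.
rewrite same_part_rel /= => /eqP xy.
have E z : glue f g z = g (perm_key s z) by case: z => i //=; rewrite fg.
by rewrite !E xy.
Qed.

Lemma perm_diagramM s t :
  perm_diagram (s * t)%g = dcomp (perm_diagram s) (perm_diagram t).
Proof.
apply: colouring_inj => f h; split=> [/colouring_perm fh|].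
  apply/colouring_comp; exists (h \o t); split; apply/colouring_perm => // i.
  by rewrite fh /= permM.
move=> /colouring_comp[g [/colouring_perm fg /colouring_perm gh]].
by apply/colouring_perm => i; rewrite fg /= gh /= permM.
Qed.

Lemma perm_diagram1 : perm_diagram 1%g = one_diagram.
Proof.
apply: colouring_inj => f g; split.
  by move=> /colouring_perm fg; apply/colouring_one => i; rewrite fg /= perm1.
by move=> /colouring_one fg; apply/colouring_perm => i; rewrite fg /= perm1.
Qed.

Lemma sym_diagramsP p : reflect (exists s, p = perm_diagram s) (p \in sym_diagrams).
Proof.
rewrite inE; apply: (iffP forall_inP) => [H|[s ->] B].
  have sE (i : 'I_n) : exists j : 'I_n,
      forall z, same_part p (inl i) z = (z \in [set inl i; inr j]).
    have [B Bp iB] := mem_part p (inl i).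
    have /existsP[a /existsP[j /eqP BE]] := H _ Bp; exists j => z.
    rewrite (same_partE _ Bp iB); move: iB; rewrite BE !inE orbF.
    by move=> /eqP[<-].
  have [s sP] := choice sE.
  have s_inj : injective s.
    move=> i j sij; have := sP i (inr (s i)); rewrite !inE eqxx orbT => si.
    have := sP j (inr (s j)); rewrite !inE eqxx orbT -sij same_part_sym => sj.
    have := same_part_trans si sj.
    by rewrite sP !inE orbF => /eqP[].
  exists (perm s_inj); apply: diagram_ext => x y; rewrite same_part_rel /=.
  have key z : same_part p z (inr (perm_key (perm s_inj) z)).
    by case: z => [i|j] /=; rewrite ?same_part_refl // permE sP !inE eqxx orbT.
  have inrP (j k : 'I_n) : same_part p (inr j) (inr k) = (j == k).
    have /codomP[i ->] := perm_onto (perm s_inj) j; rewrite permE.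
    have si : same_part p (inl i) (inr (s i)) by rewrite sP !inE eqxx orbT.
    apply/idP/eqP => [/(same_part_trans si)|->]; last exact: same_part_refl.
    by rewrite sP !inE /= => /eqP[].
  rewrite -inrP; apply/idP/idP => xy.
    by apply: same_part_trans (same_part_trans xy (key y)); rewrite same_part_sym.
  by apply: same_part_trans (same_part_trans (key x) xy) _; rewrite same_part_sym.
case/imsetP=> x _ ->; apply/existsP; exists ((s^-1)%g (perm_key s x)).
apply/existsP; exists (perm_key s x); apply/eqP/setP => -[i|i]; rewrite !inE /=.
  by rewrite orbF; apply/eqP/eqP => [->|[->]]; rewrite ?permK ?permKV.
by apply/eqP/eqP => [->|[->]].
Qed.

Lemma diag_diagramsP p :
  reflect (forall f g, colouring p f g -> f =1 g) (p \in diag_diagrams).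
Proof.
rewrite inE; apply: (iffP forallP) => [H f g fg i|H i].
  exact: (fg _ _ (H i)).
by apply/same_partP => f g /H; apply.
Qed.

Lemma sym_comp a c :
  a \in sym_diagrams -> c \in sym_diagrams -> dcomp a c \in sym_diagrams.
Proof.
move=> /sym_diagramsP[s ->] /sym_diagramsP[t ->]; rewrite -perm_diagramM.
by apply/sym_diagramsP; exists (s * t)%g.
Qed.

Lemma ltimes_comp d e : d \in ltimes_image -> e \in ltimes_image ->
  (dcomp d.1 e.1, dcomp d.2 e.2) \in ltimes_image.
Proof.
move=> /imsetP[[a b] /setXP[/= a_sym b_diag] ->].
move=> /imsetP[[a' b'] /setXP[/= a'_sym b'_diag] ->] /=.
have [s aE] := sym_diagramsP _ a_sym.
pose ainv := perm_diagram s^-1%g.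
have aV : dcomp ainv a = one_diagram.
  by rewrite aE -perm_diagramM mulVg perm_diagram1.
apply/imsetP; exists (dcomp a a', dcomp b (dcomp a (dcomp b' ainv))); last first.
  by rewrite /ltimes /= -!compA [dcomp ainv _]compA aV comp1d.
apply/setXP; split=> /=; first exact: sym_comp.
apply/diag_diagramsP => f k /colouring_comp[g [/(diag_diagramsP _ b_diag) fg]].
move=> /colouring_comp[h [+ /colouring_comp[l [/(diag_diagramsP _ b'_diag) hl]]]].
rewrite aE => /colouring_perm gh /colouring_perm lk i.
by rewrite fg gh /= hl lk /= permK.
Qed.

Lemma one_sym : one_diagram \in sym_diagrams.
Proof. by apply/sym_diagramsP; exists 1%g; rewrite perm_diagram1. Qed.

Lemma one_diag : one_diagram \in diag_diagrams.
Proof. by apply/diag_diagramsP => f g /colouring_one. Qed.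

Lemma transposition_sym i j : transposition i j \in sym_diagrams.
Proof.
rewrite inE; apply/forall_inP => B /=.
rewrite !inE => /orP[/orP[]/eqP->|/imsetP[k _ ->]].
- by apply/existsP; exists i; apply/existsP; exists j.
- by apply/existsP; exists j; apply/existsP; exists i.
- by apply/existsP; exists k; apply/existsP; exists k.
Qed.

Lemma joined_diag i j : joined i j \in diag_diagrams.
Proof.
rewrite inE; apply/forallP => k; rewrite /same_part.
have [B Bp kB] := mem_part (joined i j) (inl k).
rewrite -/(same_part _ _ _) (same_partE _ Bp kB); move: Bp kB.
rewrite !inE => /orP[/eqP->|/imsetP[l _ ->]]; rewrite !inE ?orbF /=.
  by move=> /orP[]/eqP[->]; rewrite eqxx ?orbT.
by move=> /eqP[->].
Qed.

Lemma one_ltimes : (one_diagram, one_diagram) \in ltimes_image.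
Proof.
apply/imsetP; exists (one_diagram, one_diagram); last by rewrite /ltimes comp1d.
by apply/setXP; split; [exact: one_sym | exact: one_diag].
Qed.

Lemma joined_ltimes i j : (one_diagram, joined i j) \in ltimes_image.
Proof.
apply/imsetP; exists (one_diagram, joined i j); last by rewrite /ltimes compd1.
by apply/setXP; split; [exact: one_sym | exact: joined_diag].
Qed.

Lemma transposition_ltimes i j :
  (transposition i j, transposition i j) \in ltimes_image.
Proof.
apply/imsetP; exists (transposition i j, one_diagram); last first.
  by rewrite /ltimes comp1d.
by apply/setXP; split; [exact: transposition_sym | exact: one_diag].
Qed.

Definition basis_mul (d e : ltimes_basis) : ltimes_basis :=
  @LtimesBasis (dcomp (val d).1 (val e).1, dcomp (val d).2 (val e).2)
               (ltimes_comp (valP d) (valP e)).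

Definition basis_one : ltimes_basis := LtimesBasis one_ltimes.

Lemma basis_mulA : associative basis_mul.
Proof. by move=> d e f; apply: val_inj; rewrite /= !compA. Qed.
Lemma basis_mul1l : left_id basis_one basis_mul.
Proof. by move=> d; apply: val_inj; rewrite /= !comp1d; case: (val d). Qed.
Lemma basis_mul1r : right_id basis_one basis_mul.
Proof. by move=> d; apply: val_inj; rewrite /= !compd1; case: (val d). Qed.

End Diagrams.

(* The small ramified partition algebra: the free F-module on ltimes_basis.   *)

Definition small_ramified (F : fieldType) n := {ffun ltimes_basis n -> F^o}.

HB.instance Definition _ F n := GRing.Zmodule.on (small_ramified F n).
HB.instance Definition _ F n := GRing.Lmodule.on (small_ramified F n).

(* Locked, as conversion would otherwise enumerate the basis. *)
HB.lock Definition basis_elt (F : fieldType) n (d : ltimes_basis n) :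
  small_ramified F n := [ffun e => (e == d)%:R].

Section SmallRamified.
Variables (F : fieldType) (n : nat).

Local Notation small_ramified := (small_ramified F n).
Local Notation basis_elt := (@basis_elt F n).

Implicit Types (f g h : small_ramified) (d e : ltimes_basis n).

Lemma basis_eltE d e : basis_elt d e = (e == d)%:R.
Proof. by rewrite unlock ffunE. Qed.

Definition sr_mul f g : small_ramified :=
  \sum_d \sum_e (f d * g e) *: basis_elt (basis_mul d e).

Lemma sr_expand f : f = \sum_d f d *: basis_elt d.
Proof.
apply/ffunP => e; rewrite sum_ffunE (bigD1 e) //= big1 ?addr0 => [|d de].
  by rewrite ffunE basis_eltE eqxx [RHS]mulr1.
by rewrite ffunE basis_eltE eq_sym (negbTE de) [LHS]mulr0.
Qed.

Lemma sr_mulDl : left_distributive sr_mul +%R.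
Proof.
move=> f g h; rewrite /sr_mul -big_split; apply: eq_bigr => d _ /=.
rewrite -big_split; apply: eq_bigr => e _ /=.
by rewrite ffunE mulrDl scalerDl.
Qed.
Lemma sr_mulDr : right_distributive sr_mul +%R.
Proof.
move=> f g h; rewrite /sr_mul -big_split; apply: eq_bigr => d _ /=.
rewrite -big_split; apply: eq_bigr => e _ /=.
by rewrite ffunE mulrDr scalerDl.
Qed.
Lemma sr_mul0l : left_zero 0 sr_mul.
Proof.
move=> f; rewrite /sr_mul big1 // => d _; rewrite big1 // => e _.
by rewrite ffunE mul0r scale0r.
Qed.
Lemma sr_mul0r : right_zero 0 sr_mul.
Proof.
move=> f; rewrite /sr_mul big1 // => d _; rewrite big1 // => e _.
by rewrite ffunE mulr0 scale0r.
Qed.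
Lemma sr_mulZl a f g : a *: sr_mul f g = sr_mul (a *: f) g.
Proof.
rewrite /sr_mul scaler_sumr; apply: eq_bigr => d _.
rewrite scaler_sumr; apply: eq_bigr => e _.
by rewrite scalerA ffunE mulrA.
Qed.
Lemma sr_mulZr a f g : a *: sr_mul f g = sr_mul f (a *: g).
Proof.
rewrite /sr_mul scaler_sumr; apply: eq_bigr => d _.
rewrite scaler_sumr; apply: eq_bigr => e _.
by rewrite scalerA ffunE mulrCA.
Qed.

Lemma sr_mul_suml (I : finType) (G : I -> small_ramified) g :
  sr_mul (\sum_i G i) g = \sum_i sr_mul (G i) g.
Proof.
apply: (big_morph (sr_mul^~ g)); last exact: sr_mul0l.
by move=> x y; apply: sr_mulDl.
Qed.
Lemma sr_mul_sumr (I : finType) (G : I -> small_ramified) g :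
  sr_mul g (\sum_i G i) = \sum_i sr_mul g (G i).
Proof.
apply: (big_morph (sr_mul g)); last exact: sr_mul0r.
by move=> x y; apply: sr_mulDr.
Qed.

Lemma sr_mulE d e :
  sr_mul (basis_elt d) (basis_elt e) = basis_elt (basis_mul d e).
Proof.
rewrite /sr_mul (bigD1 d) //= [X in _ + X]big1 => [|d' dd']; last first.
  rewrite big1 // => e' _.
  by rewrite [basis_elt d d']basis_eltE (negbTE dd') mul0r scale0r.
rewrite addr0 (bigD1 e) //= [X in _ + X]big1 => [|e' ee']; last first.
  by rewrite [basis_elt e e']basis_eltE (negbTE ee') mulr0 scale0r.
by rewrite addr0 !basis_eltE !eqxx mulr1 scale1r.
Qed.

Lemma sr_mul_expl f g : sr_mul f g = \sum_d f d *: sr_mul (basis_elt d) g.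
Proof.
rewrite [in LHS](sr_expand f) sr_mul_suml.
by apply: eq_bigr => d _; rewrite -sr_mulZl.
Qed.
Lemma sr_mul_expr f g : sr_mul f g = \sum_d g d *: sr_mul f (basis_elt d).
Proof.
rewrite [in LHS](sr_expand g) sr_mul_sumr.
by apply: eq_bigr => d _; rewrite -sr_mulZr.
Qed.

Lemma sr_mulA : associative sr_mul.
Proof.
move=> f g h.
rewrite (sr_mul_expl f (sr_mul g h)) (sr_mul_expl f g) sr_mul_suml.
apply: eq_bigr => a _; rewrite -sr_mulZl; congr (_ *: _).
rewrite (sr_mul_expl g h) (sr_mul_expr _ g) sr_mul_suml sr_mul_sumr.
apply: eq_bigr => b _; rewrite -sr_mulZr -sr_mulZl; congr (_ *: _).
rewrite sr_mulE (sr_mul_expr _ h) (sr_mul_expr _ h) sr_mul_sumr.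
by apply: eq_bigr => c _; rewrite -sr_mulZr !sr_mulE basis_mulA.
Qed.
Lemma sr_mul1l : left_id (basis_elt (basis_one n)) sr_mul.
Proof.
move=> f; rewrite sr_mul_expr [RHS]sr_expand.
by apply: eq_bigr => d _; rewrite sr_mulE basis_mul1l.
Qed.
Lemma sr_mul1r : right_id (basis_elt (basis_one n)) sr_mul.
Proof.
move=> f; rewrite sr_mul_expl [RHS]sr_expand.
by apply: eq_bigr => d _; rewrite sr_mulE basis_mul1r.
Qed.
Lemma sr_oner_neq0 : basis_elt (basis_one n) != 0.
Proof.
apply/eqP => /ffunP/(_ (basis_one n))/eqP.
by rewrite basis_eltE ffunE eqxx oner_eq0.
Qed.

HB.instance Definition _ := GRing.Zmodule_isNzRing.Build small_ramified
  sr_mulA sr_mul1l sr_mul1r sr_mulDl sr_mulDr sr_oner_neq0.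
HB.instance Definition _ :=
  GRing.Lmodule_isLalgebra.Build F small_ramified sr_mulZl.
HB.instance Definition _ :=
  GRing.Lalgebra_isAlgebra.Build F small_ramified sr_mulZr.

End SmallRamified.

(* The vertices i and i + 1 attached to the generator index i. *)
Lemma fst_index_subproof n (i : 'I_n.-1) : (i < n)%N.
Proof. exact: leq_trans (ltn_ord i) (leq_pred n). Qed.
Lemma snd_index_subproof n (i : 'I_n.-1) : (i.+1 < n)%N.
Proof. by case: n i => [[]|n i] //; rewrite ltnS ltn_ord. Qed.

Definition fst_index n (i : 'I_n.-1) : 'I_n := Ordinal (fst_index_subproof i).
Definition snd_index n (i : 'I_n.-1) : 'I_n := Ordinal (snd_index_subproof i).

Section Images.
Variables (F : fieldType) (n : nat) (i : 'I_n.-1).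

Definition image_E : small_ramified F n :=
  basis_elt F
    (@LtimesBasis n (one_diagram n, joined (fst_index i) (snd_index i))
                  (joined_ltimes _ _)).

Definition image_T : small_ramified F n :=
  basis_elt F
    (@LtimesBasis n (transposition (fst_index i) (snd_index i),
                     transposition (fst_index i) (snd_index i))
                  (transposition_ltimes _ _)).

End Images.

(* Main.v *)
Require Import Defs.
From HB Require Import structures.
From mathcomp Require Import all_boot all_order all_algebra fingroup perm.
From mathcomp Require Import zify generic_quotient boolp reals complex.
Set Implicit Arguments.
Unset Strict Implicit.
Unset Printing Implicit Defensive.

Import GRing.Theory.
Local Open Scope ring_scope.

(** At u = 1 the quadratic relation says T_i ^ 2 = 1, so with the braid relations
the T_i satisfy the Coxeter presentation of the symmetric group and define a
homomorphism tau from it (section Coxeter, lemma tauM). The conjugates of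
E_1 under tau form a family of elements tie a b indexed by pairs of points:
tie a b is well defined because the stabiliser of the points 1 and 2 is
generated by T_3, T_4, ..., which commute with E_1 (tie0E), and the shift
relation E_(i+1) T_i T_(i+1) = T_i T_(i+1) E_i says that E_i is the tie of
i and i + 1 (tie_node). Conjugating the defining relations that involve the
first four points shows that ties are commuting idempotents with
tie a b * tie b c = tie a b * tie a c (tie_three, tie_comm). Hence the
product of the ties over a set of pairs depends only on the equivalence
relation that the pairs generate (tie_rel_join).

A basis element of the small ramified partition algebra is a pair
(s, D s) with s a permutation and D a diagonal diagram, and it is determined
by s and by the equivalence relation that D s induces on the top vertices
(colouring_basis, basis_ext). Let psi be the linear map that sends it to the
product of the ties over that relation, times tau s. Multiplying (s, D s) on
the right by the image of T_i multiplies s by a transposition and leaves the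
top relation unchanged; multiplying by the image of E_i adds to the top
relation the pair (s^-1 i, s^-1 (i + 1)). So psi intertwines right
multiplication by phi x with right multiplication by x when x is a generator,
hence for all x (psi_phi_mul); taking 1 as the other factor gives
psi (phi x) = x. Conversely phi (psi d) = d is a computation with diagrams
(psiK_basis). The map phi exists because the images of the generators satisfy
the relations (gen_image_rel).

Equalities of diagrams are proved through two-colourings of the vertices that
are constant on parts: they determine the diagram and compose as relations,
so no path in a stacked diagram has to be followed. The same device is used
in the algebra: for a product v of ties, whether v absorbs tie x z is a
two-colouring of the points z. *)

(** * The Coxeter presentation of the symmetric group *)

Section Coxeter.
Variable N : nat.
Implicit Types (i j k m : nat) (u v w : seq nat).

(** The congruence on words that presents the symmetric group; words with
    letters below N stand for products of adjacent transpositions of N + 1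
    points. Keeping words apart from their values allows the same normal form to
    be evaluated both in permutations and in an algebra. *)
Inductive cox : seq nat -> seq nat -> Prop :=
  | cox_refl u : cox u u
  | cox_sym u v : cox u v -> cox v u
  | cox_trans u v w : cox u v -> cox v w -> cox u w
  | cox_cat u u' v v' : cox u u' -> cox v v' -> cox (u ++ v) (u' ++ v')
  | cox_sq i : (i < N)%N -> cox [:: i; i] [::]
  | cox_far i j : (i.+1 < j < N)%N -> cox [:: i; j] [:: j; i]
  | cox_braid i : (i.+1 < N)%N -> cox [:: i; i.+1; i] [:: i.+1; i; i.+1].

Lemma cox_catl u v v' : cox v v' -> cox (u ++ v) (u ++ v').
Proof. exact/cox_cat/cox_refl. Qed.

Lemma cox_catr u u' v : cox u u' -> cox (u ++ v) (u' ++ v).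
Proof. by move/cox_cat; apply; apply: cox_refl. Qed.

Definition coxeter_family (M : Type) (one : M) (mul : Monoid.law one)
    (t : nat -> M) :=
  [/\ forall i, (i < N)%N -> mul (t i) (t i) = one,
      forall i j, (i.+1 < j < N)%N -> mul (t i) (t j) = mul (t j) (t i)
    & forall i, (i.+1 < N)%N ->
        mul (t i) (mul (t i.+1) (t i)) = mul (t i.+1) (mul (t i) (t i.+1))].

Lemma cox_eval (M : Type) (one : M) (mul : Monoid.law one) (t : nat -> M) u v :
  coxeter_family mul t -> cox u v ->
  \big[mul/one]_(i <- u) t i = \big[mul/one]_(i <- v) t i.
Proof.
case=> sq far braid; elim=> {u v} //.
- by move=> u v w _ -> _ ->.
- by move=> u u' v v' _ Eu _ Ev; rewrite !big_cat /= Eu Ev.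
- by move=> i iN; rewrite !big_cons !big_nil Monoid.mulm1 sq.
- by move=> i j ij; rewrite !big_cons !big_nil !Monoid.mulm1 far.
- by move=> i iN; rewrite !big_cons !big_nil !Monoid.mulm1 braid.
Qed.

Definition letters k u := all (fun i => k <= i < N)%N u.

Lemma letters_cat k u v : letters k (u ++ v) = letters k u && letters k v.
Proof. exact: all_cat. Qed.

Lemma cox_far_word i u : (i < N)%N ->
  all (fun j => (j < N) && ((i.+1 < j) || (j.+1 < i)))%N u ->
  cox (u ++ [:: i]) (i :: u).
Proof.
move=> iN; elim: u => [_|j u IHu] /=; first exact: cox_refl.
move=> /andP[/andP[jN ij] /IHu {}IHu].
apply: (@cox_trans _ ([:: j; i] ++ u)).
  exact: (@cox_catl [:: j]).
apply: (@cox_catr [:: j; i] [:: i; j]).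
case/orP: ij => ij; last by apply: cox_far; rewrite ij.
by apply/cox_sym/cox_far; rewrite ij.
Qed.

Lemma iota_letters k m : (k + m <= N)%N -> letters k (iota k m).
Proof. by move=> kmN; apply/allP => i; rewrite mem_iota; lia. Qed.

(** A letter i after the run k, k + 1, ..., k + m - 1 lengthens it, shortens it,
    commutes past it, or, when i and i + 1 both occur in the run, passes it and
    comes out as i + 1 by the braid relation. The letters that come out on the
    left always exceed k. *)
Lemma run_letter k m i : (k + m <= N)%N -> (k <= i < N)%N ->
  exists w m', [/\ letters k.+1 w, (k + m' <= N)%N
                 & cox (iota k m ++ [:: i]) (w ++ iota k m')].
Proof.
move=> kmN /andP[ki iN].
have [iE|im] := eqVneq i (k + m)%N.
  exists [::], m.+1; split=> //; first lia.
  by rewrite iE -addn1 iotaD; apply: cox_refl.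
have [im1|im1] := eqVneq i.+1 (k + m)%N.
  have mE : m = (m.-1 + 1)%N by lia.
  exists [::], m.-1; split=> //; first lia.
  rewrite {1}mE iotaD -catA -[X in cox _ X]cats0; apply: cox_catl => /=.
  by rewrite (_ : k + m.-1 = i)%N; [exact: cox_sq | lia].
have [ikm|kmi] := ltnP (k + m) i.
  exists [:: i], m; split=> //; first by rewrite /letters /= andbT; lia.
  apply: cox_far_word => //; apply/allP => j; rewrite mem_iota.
  lia.
exists [:: i.+1], m; split=> //; first by rewrite /letters /= andbT; lia.
pose b := iota i.+2 (k + m - i.+2).
have -> : iota k m = iota k (i - k) ++ [:: i; i.+1] ++ b.
  have -> : m = ((i - k) + (2 + (k + m - i.+2)))%N by lia.
  by rewrite iotaD; congr (_ ++ _); rewrite subnKC // iotaD addn2.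
apply: (@cox_trans _ (iota k (i - k) ++ [:: i; i.+1; i] ++ b)).
  rewrite -!catA; apply: cox_catl.
  apply: (@cox_catl [:: i; i.+1] (b ++ [:: i]) (i :: b)).
  by apply: cox_far_word => //; apply/allP => j; rewrite mem_iota; lia.
apply: (@cox_trans _ (iota k (i - k) ++ [:: i.+1] ++ [:: i; i.+1] ++ b)).
  apply: cox_catl; rewrite [X in cox _ X]catA; apply: cox_catr.
  by apply: cox_braid; lia.
rewrite [X in cox X _]catA [X in cox _ X]catA; apply: cox_catr.
apply: cox_far_word; first lia.
by apply/allP => j; rewrite mem_iota; lia.
Qed.

(** The runs starting at k represent the cosets, in the group generated by the
    letters from k on, of the subgroup generated by those from k + 1 on. *)
Lemma cox_normal_form k u : (k <= N)%N -> letters k u ->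
  exists w m, [/\ letters k.+1 w, (k + m <= N)%N & cox u (w ++ iota k m)].
Proof.
move=> kN; elim/last_ind: u => [_|u i IHu].
  by exists [::], 0%N; rewrite addn0; split=> //; apply: cox_refl.
rewrite /letters all_rcons => /andP[ki /IHu[w [m [wk mN uw]]]].
have [w' [m' [wk' mN' Ei]]] := run_letter mN ki.
have ww : letters k.+1 (w ++ w') by rewrite letters_cat wk.
exists (w ++ w'), m'; split=> //.
rewrite -cats1; apply: cox_trans (cox_catr _ uw) _.
by rewrite -!catA; apply: cox_catl.
Qed.

Definition node i : 'I_N.+1 := inord i.
Definition swap i : 'S_N.+1 := tperm (node i) (node i.+1).
Definition wperm u : 'S_N.+1 := (\prod_(i <- u) swap i)%g.

Lemma node_eq i j : (i <= N)%N -> (j <= N)%N -> (node i == node j) = (i == j).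
Proof. by move=> iN jN; rewrite -val_eqE /= !inordK. Qed.

Lemma swapL i : swap i (node i) = node i.+1.
Proof. exact: tpermL. Qed.
Lemma swapR i : swap i (node i.+1) = node i.
Proof. exact: tpermR. Qed.
Lemma swapD i j : (i < N)%N -> (j <= N)%N -> j != i -> j != i.+1 ->
  swap i (node j) = node j.
Proof.
by move=> iN jN ji ji1; rewrite tpermD // node_eq 1?eq_sym // ltnW.
Qed.

Lemma swap_conj i j (s : 'S_N.+1) :
    s (node i) = node j -> s (node i.+1) = node j.+1 ->
  (s * swap j = swap i * s)%g.
Proof. by move=> si si1; rewrite [RHS]conjgC tpermJ si si1. Qed.

Lemma swap_coxeter : @coxeter_family 'S_N.+1 1%g mulg swap.
Proof.
split=> [i iN|i j ij|i iN] /=; first exact: tperm2.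
- by apply: swap_conj; rewrite swapD //; lia.
- rewrite mulgA; apply: swap_conj.
    by rewrite permM swapR swapD //; lia.
  by rewrite permM swapD ?swapR //; lia.
Qed.

Lemma wperm_cat u v : wperm (u ++ v) = (wperm u * wperm v)%g.
Proof. exact: big_cat. Qed.

Lemma wperm_fix k u i : letters k u -> (i < k)%N -> (i <= N)%N ->
  wperm u (node i) = node i.
Proof.
rewrite /wperm => + ik iN; elim: u => [_|j u IHu] /=.
  by rewrite big_nil perm1.
move=> /andP[/andP[kj jN] /IHu {}IHu].
by rewrite big_cons permM swapD //; lia.
Qed.

Lemma wperm_run k m : (k + m <= N)%N ->
  wperm (iota k m) (node k) = node (k + m).
Proof.
elim: m k => [|m IHm] k kmN; first by rewrite /wperm big_nil perm1 addn0.
rewrite /wperm /= big_cons permM swapL addnS -addSn; apply: IHm; lia.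
Qed.

Lemma cox_wperm u v : cox u v -> wperm u = wperm v.
Proof. exact: (cox_eval swap_coxeter). Qed.

(** The relations suffice: in normal form w ++ iota k m, the word w fixes the
    point k, so m is read off from the image of k, and cancelling the run
    reduces to words with letters from k + 1 on. *)
Lemma wperm_cox k u v : letters k u -> letters k v -> wperm u = wperm v ->
  cox u v.
Proof.
have [d] := ubnP (N - k); elim: d k u v => // d IHd k u v kd uk vk uv.
have [Nk|kN] := leqP N k.
  have nilw w : letters k w -> w = [::] by case: w => //= i w; lia.
  by rewrite (nilw u) // (nilw v) //; apply: cox_refl.
have [u' [m [uk' mN Eu]]] := cox_normal_form (ltnW kN) uk.
have [v' [l [vk' lN Ev]]] := cox_normal_form (ltnW kN) vk.
have Eml : m = l.
  move: uv; rewrite (cox_wperm Eu) (cox_wperm Ev) => /permP/(_ (node k)).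
  rewrite !wperm_cat !permM (wperm_fix uk') ?(wperm_fix vk') ?(ltnW kN) //.
  rewrite !wperm_run //.
  by move/eqP; rewrite node_eq // => /eqP; lia.
subst l; have u'v' : wperm u' = wperm v'.
  move: uv; rewrite (cox_wperm Eu) (cox_wperm Ev) !wperm_cat.
  exact: mulIg.
apply: cox_trans Eu _; apply: cox_trans _ (cox_sym Ev).
by apply/cox_catr/(IHd k.+1) => //; lia.
Qed.

(** The subgroup fixing the points below k is generated by the adjacent
    transpositions from k on; the case k = 2 gives the stabiliser of the first
    two points. *)
Lemma perm_word k (s : 'S_N.+1) :
  (forall i, (i < k)%N -> (i <= N)%N -> s (node i) = node i) ->
  exists2 u, letters k u & wperm u = s.
Proof.
have [d] := ubnP (N - k); elim: d k s => // d IHd k s kd sk.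
have [Nk|kN] := leqP N k.
  (* A permutation fixing every point but the last one also fixes that one. *)
  exists [::] => //; rewrite /wperm big_nil; apply/esym/permP => x.
  have xE : x = node x by rewrite [RHS]inord_val.
  have sfix y : y != ord_max -> s y = y.
    move=> ymax; have yE : y = node y by rewrite [RHS]inord_val.
    rewrite yE sk //; last exact: (ltn_ord y).
    apply: leq_trans Nk; rewrite ltn_neqAle -ltnS ltn_ord andbT.
    by apply: contra ymax => /eqP yN; apply/eqP/val_inj.
  rewrite perm1; have [->|/sfix //] := eqVneq x ord_max.
  apply/eqP/negPn/negP => /[dup] smax /sfix /perm_inj E.
  by rewrite E eqxx in smax.
pose j : nat := s (node k).
have jE : s (node k) = node j by rewrite [RHS]inord_val.
have jN : (j <= N)%N by exact: (ltn_ord (s (node k))).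
have kj : (k <= j)%N.
  rewrite leqNgt; apply/negP => jk; have := sk j jk jN.
  rewrite -jE => /perm_inj/eqP; rewrite jE node_eq ?(ltnW kN) //.
  by move/eqP; lia.
have kjN : (k + (j - k) <= N)%N by rewrite subnKC.
have [||u uk uE] := IHd k.+1 (s * (wperm (iota k (j - k)))^-1)%g; first lia.
  move=> i; rewrite ltnS leq_eqVlt permM => /orP[/eqP-> _|ik iN].
    by apply: (canLR (permK _)); rewrite wperm_run // subnKC.
  apply: (canLR (permK _)); rewrite sk // (wperm_fix (k := k)) //.
  exact: iota_letters.
exists (u ++ iota k (j - k)); last by rewrite wperm_cat uE mulgKV.
rewrite letters_cat iota_letters // andbT.
by apply: sub_all uk => i /andP[/ltnW-> ->].
Qed.
End Coxeter.

Lemma word_exists N (s : 'S_N.+1) : exists2 u, letters N 0 u & wperm N u = s.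
Proof. exact: perm_word. Qed.

Definition word N (s : 'S_N.+1) : seq nat :=
  sval (cid2 (word_exists s)).

Lemma word_letters N (s : 'S_N.+1) : letters N 0 (word s).
Proof. by rewrite /word; case: cid2. Qed.

Lemma wperm_word N (s : 'S_N.+1) : wperm N (word s) = s.
Proof. by rewrite /word; case: cid2. Qed.

Lemma perm_extend N (l : seq 'I_N.+1) : uniq l ->
  exists g : 'S_N.+1, forall i, (i < size l)%N -> g (node N i) = nth ord0 l i.
Proof.
elim/last_ind: l => [_|l x IHl]; first by exists 1%g.
move=> /[dup] /card_uniqP; rewrite size_rcons => lN.
rewrite rcons_uniq => /andP[xl /IHl[g gE]].
have {}lN : (size l <= N)%N.
  by rewrite -ltnS -lN -[X in (_ <= X)%N]card_ord max_card.
exists (g * tperm (g (node N (size l))) x)%g => i; rewrite ltnS leq_eqVlt permM.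
case/orP=> [/eqP->|il]; first by rewrite tpermL nth_rcons ltnn eqxx.
rewrite nth_rcons il tpermD; first exact: gE.
- by rewrite (inj_eq perm_inj) node_eq ?gtn_eqF // (leq_trans (ltnW il)).
- by apply: contra xl => /eqP->; rewrite gE // mem_nth.
Qed.

(** * Ties in an algebra of braids and ties at u = 1 *)

Section Ties.
Variables (N : nat) (R : pzRingType) (t e : nat -> R).

(** Natural numbers, constrained below N, serve as indices to spare index
    arithmetic in ordinals. *)
Record ties_family : Prop := TiesFamily {
  ties_coxeter : coxeter_family N *%R t;
  ties_comm : forall i j, (i < N)%N -> (j < N)%N -> e i * e j = e j * e i;
  ties_idem : forall i, (i < N)%N -> e i * e i = e i;
  ties_swap : forall i, (i < N)%N -> e i * t i = t i * e i;
  ties_far : forall i j, (i.+1 < j < N)%N -> e i * t j = t j * e i;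
  ties_shift : forall i, (i.+1 < N)%N ->
    e i.+1 * t i * t i.+1 = t i * t i.+1 * e i;
  ties_trans : forall i, (i.+1 < N)%N ->
    e i * e i.+1 * t i.+1 = e i * t i.+1 * e i }.

Hypothesis tiesP : ties_family.

Local Notation node := (node N).
Local Notation swap := (swap N).
Implicit Types (a b c d : 'I_N.+1) (g s : 'S_N.+1) (r : rel 'I_N.+1).

Definition tau s : R := \prod_(i <- word s) t i.

Lemma tau_wperm u : letters N 0 u -> tau (wperm N u) = \prod_(i <- u) t i.
Proof.
move=> u0; apply: (cox_eval (ties_coxeter tiesP)).
by apply: (wperm_cox (word_letters _) u0); rewrite wperm_word.
Qed.

Lemma tauM s g : tau (s * g)%g = tau s * tau g.
Proof.
rewrite -[s in LHS]wperm_word -[g in LHS]wperm_word -wperm_cat tau_wperm.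
  exact: big_cat.
by rewrite letters_cat !word_letters.
Qed.

Lemma tau1 : tau 1%g = 1.
Proof.
rewrite -[1%g]/(1%g : 'S_N.+1) (_ : 1%g = wperm N [::]); last first.
  by rewrite /wperm big_nil.
by rewrite tau_wperm // big_nil.
Qed.

Lemma tau_swap i : (i < N)%N -> tau (swap i) = t i.
Proof.
move=> iN; have -> : swap i = wperm N [:: i] by rewrite /wperm big_seq1.
by rewrite tau_wperm ?big_seq1 // /letters /= iN.
Qed.

Lemma tauVK s : tau s^-1%g * tau s = 1.
Proof. by rewrite -tauM mulVg tau1. Qed.

Lemma tauKV s : tau s * tau s^-1%g = 1.
Proof. by rewrite -tauM mulgV tau1. Qed.

(** For distinct a and b, the first factor sends the first point to a, and the
    second one sends the image of the second point to b and fixes a. *)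
Definition carry a b : 'S_N.+1 :=
  (tperm (node 0) a * tperm (tperm (node 0) a (node 1)) b)%g.

Lemma carry1 a b : carry a b (node 1) = b.
Proof. by rewrite permM tpermL. Qed.

Lemma carry0 a b : (0 < N)%N -> a != b -> carry a b (node 0) = a.
Proof.
move=> N0 ab; rewrite permM tpermL; apply: tpermD; last by rewrite eq_sym.
by rewrite -[X in _ == X](tpermL (node 0) a) (inj_eq perm_inj) node_eq.
Qed.

Lemma ties_N_gt0 a b : a != b -> (0 < N)%N.
Proof. by case: N a b => // a b; rewrite (ord1 a) (ord1 b). Qed.

Lemma carryP a b : a != b ->
  exists g, [/\ (0 < N)%N, g (node 0) = a & g (node 1) = b].
Proof.
move=> ab; have N0 := ties_N_gt0 ab.
by exists (carry a b); rewrite carry0 // carry1.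
Qed.

Definition conj_tau (x : R) g : R := tau g^-1%g * x * tau g.

Lemma conj_tauM x s g : conj_tau (conj_tau x s) g = conj_tau x (s * g)%g.
Proof. by rewrite /conj_tau invMg !tauM !mulrA. Qed.

Lemma conj_tau_mul x y s : conj_tau (x * y) s = conj_tau x s * conj_tau y s.
Proof.
rewrite /conj_tau -!mulrA; congr (_ * (_ * _)).
by rewrite [RHS]mulrA tauKV mul1r.
Qed.

Lemma conj_tau_fix x s : x * tau s = tau s * x -> conj_tau x s = x.
Proof. by rewrite /conj_tau -mulrA => ->; rewrite mulrA tauVK mul1r. Qed.

Lemma conj_tau1 s : conj_tau 1 s = 1.
Proof. by rewrite /conj_tau mulr1 tauVK. Qed.

(** The value 1 on the diagonal makes absorption of ties reflexive. *)
Definition tie a b : R := if a == b then 1 else conj_tau (e 0) (carry a b).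

Lemma tie_refl a : tie a a = 1.
Proof. by rewrite /tie eqxx. Qed.

Lemma conj_tau_stab s :
    (0 < N)%N -> s (node 0) = node 0 -> s (node 1) = node 1 ->
  conj_tau (e 0) s = e 0.
Proof.
move=> N0 s0 s1; apply: conj_tau_fix.
have [|u u2 <-] := @perm_word N 2 s; first by case=> [|[|]].
have u0 : letters N 0 u by apply: sub_all u2 => i /andP[_ ->].
rewrite tau_wperm // big_seq; apply: commr_prod => i /(allP u2) iN.
exact: ties_far.
Qed.

(** Any permutation that sends the first two points to a and b can serve to
    define tie a b: two of them differ by an element of the stabiliser. *)
Lemma tie0E g : (0 < N)%N -> tie (g (node 0)) (g (node 1)) = conj_tau (e 0) g.
Proof.
move=> N0; have g01 : g (node 0) != g (node 1).
  by rewrite (inj_eq perm_inj) node_eq.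
rewrite /tie (negbTE g01); set h := carry _ _.
rewrite -[g in RHS](mulgKV h) -[RHS]conj_tauM.
rewrite [conj_tau _ (g * _)%g]conj_tau_stab //;
  rewrite permM; apply: (canLR (permK _)).
- by rewrite carry0.
- by rewrite carry1.
Qed.

(** By the shift relation, e (i + 1) is the conjugate of e i by a product of two
    adjacent transpositions. *)
Lemma tieE i g : (i < N)%N ->
  tie (g (node i)) (g (node i.+1)) = conj_tau (e i) g.
Proof.
elim: i g => [|i IHi] g iN; first exact: tie0E.
have {IHi} IH := IHi (swap i.+1 * swap i * g)%g (ltnW iN).
have -> : e i.+1 = conj_tau (e i) (swap i.+1 * swap i)%g.
  rewrite /conj_tau invMg !tauM !tpermV -!/(swap _) !tau_swap ?(ltnW iN) //.
  rewrite -(ties_shift tiesP) // -[in X in X * (_ * _)]mulrA !mulrA.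
  have [sq _ _] := ties_coxeter tiesP.
  by rewrite -!mulrA [t i.+1 * (_ * _)]mulrA sq // mul1r sq ?mulr1 // ltnW.
rewrite conj_tauM -IH !permM.
rewrite (@swapD N i.+1 i) ?(ltnW iN) // ?ltnn //; try lia.
by rewrite !swapL (@swapD N i i.+2) //; lia.
Qed.

Lemma tie_node i : (i < N)%N -> tie (node i) (node i.+1) = e i.
Proof.
move=> iN; have := tieE 1%g iN; rewrite !perm1 => ->.
by apply: conj_tau_fix; rewrite tau1 mulr1 mul1r.
Qed.

Lemma conj_tie a b s : conj_tau (tie a b) s = tie (s a) (s b).
Proof.
have [->|/carryP[g [N0 <- <-]]] := eqVneq a b.
  by rewrite !tie_refl conj_tau1.
by rewrite tie0E // -!permM tie0E // conj_tauM.
Qed.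

Lemma tau_tie a b s : tau s * tie (s a) (s b) = tie a b * tau s.
Proof. by rewrite -conj_tie /conj_tau !mulrA tauKV mul1r. Qed.

Lemma tieC a b : tie a b = tie b a.
Proof.
have [->//|/carryP[g [N0 <- <-]]] := eqVneq a b.
have := tie0E (swap 0 * g)%g N0; rewrite !permM swapL swapR tie0E // => ->.
rewrite -conj_tauM [conj_tau _ (swap 0)]conj_tau_fix // tau_swap //.
exact: ties_swap.
Qed.

Lemma tie_idem a b : tie a b * tie a b = tie a b.
Proof.
have [->|/carryP[g [N0 <- <-]]] := eqVneq a b.
  by rewrite !tie_refl mulr1.
by rewrite tie0E // -conj_tau_mul ties_idem.
Qed.

(** By conjugation, it suffices to treat the first three points, where the two
    equations are the commutation of e 0 and e 1 and the relation ties_trans. *)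
Lemma tie_three a b c :
  tie a b * tie b c = tie b c * tie a b /\
  tie a b * tie b c = tie a b * tie a c.
Proof.
have [->|ab] := eqVneq a b; first by rewrite !tie_refl !(mul1r, mulr1).
have [->|bc] := eqVneq b c; first by rewrite !tie_refl tie_idem !(mul1r, mulr1).
have [->|ac] := eqVneq a c.
  by rewrite tie_refl (tieC b) tie_idem mulr1.
have abc : uniq [:: a; b; c] by rewrite /= !inE negb_or ab ac bc.
have N1 : (1 < N)%N.
  by have := max_card (mem [:: a; b; c]); rewrite card_ord (card_uniqP abc).
have [g gE] := perm_extend abc.
have <- : g (node 0) = a by rewrite gE.
have <- : g (node 1) = b by rewrite gE.
have <- : g (node 2) = c by rewrite gE.
rewrite -!conj_tie -!conj_tau_mul !tie_node ?(ltnW N1) //.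
split; first by congr conj_tau; apply: ties_comm => //; apply: ltnW.
have N0 := ltnW N1.
have -> : tie (node 0) (node 2) = conj_tau (e 0) (swap 1).
  rewrite -tie_node // conj_tie swapL swapD //.
congr conj_tau; rewrite /conj_tau tpermV -/(swap 1) tau_swap // !mulrA.
rewrite -ties_trans // -!mulrA.
by have [-> //] := ties_coxeter tiesP; rewrite mulr1.
Qed.

Lemma tie_comm a b c d : tie a b * tie c d = tie c d * tie a b.
Proof.
have [<-|bc] := eqVneq b c; first by case: (tie_three a b d).
have [<-|ac] := eqVneq a c.
  by rewrite (tieC a b); case: (tie_three b a d).
have [<-|bd] := eqVneq b d.
  by rewrite (tieC c b); case: (tie_three a b c).
have [<-|ad] := eqVneq a d.
  by rewrite (tieC a b) (tieC c a); case: (tie_three b a c).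
have [->|ab] := eqVneq a b; first by rewrite tie_refl mul1r mulr1.
have [->|cd] := eqVneq c d; first by rewrite tie_refl mul1r mulr1.
have abcd : uniq [:: a; b; c; d].
  by rewrite /= !inE !negb_or ab ac ad bc bd cd.
have N2 : (2 < N)%N.
  by have := max_card (mem [:: a; b; c; d]); rewrite card_ord (card_uniqP abcd).
have [g gE] := perm_extend abcd.
have <- : g (node 0) = a by rewrite gE.
have <- : g (node 1) = b by rewrite gE.
have <- : g (node 2) = c by rewrite gE.
have <- : g (node 3) = d by rewrite gE.
rewrite -!conj_tie -!conj_tau_mul !tie_node //; last lia.
by congr conj_tau; apply: ties_comm => //; lia.
Qed.

Lemma absorb_trans (x : R) a b c :
  x * tie a b = x -> x * tie b c = x -> x * tie a c = x.
Proof.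
move=> xab xbc; rewrite -{1}xab -mulrA.
by have [_ <-] := tie_three a b c; rewrite mulrA xab.
Qed.

Definition tie_rel (r : rel 'I_N.+1) : R :=
  \prod_(p : 'I_N.+1 * 'I_N.+1 | r p.1 p.2) tie p.1 p.2.

Lemma eq_tie_rel r r' : r =2 r' -> tie_rel r = tie_rel r'.
Proof. by move=> rr'; apply: eq_bigl => p; apply: rr'. Qed.

Lemma tie_rel_comm r a b : tie_rel r * tie a b = tie a b * tie_rel r.
Proof. by apply: esym; apply: commr_prod => p _; apply: tie_comm. Qed.

Lemma tie_rel_absorb r a b : r a b -> tie_rel r * tie a b = tie_rel r.
Proof.
move=> rab; rewrite /tie_rel -big_filter.
have : (a, b) \in [seq p <- index_enum ('I_N.+1 * 'I_N.+1)%type | r p.1 p.2].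
  by rewrite mem_filter rab mem_index_enum.
elim: [seq _ <- _ | _] => //= p l IHl; rewrite inE big_cons -mulrA.
case/orP=> [/eqP<-|/IHl-> //].
have <- : tie a b * \prod_(q <- l) tie q.1 q.2 =
          \prod_(q <- l) tie q.1 q.2 * tie a b.
  by apply: commr_prod => q _; apply: tie_comm.
by rewrite mulrA tie_idem.
Qed.

Lemma absorb_tie_rel (x : R) r :
  (forall a b, r a b -> x * tie a b = x) -> x * tie_rel r = x.
Proof.
move=> xr; rewrite /tie_rel.
elim/big_rec: _ => [|p y /xr xp xy]; first exact: mulr1.
by rewrite mulrA xp.
Qed.

(** The hypothesis says that r' is the equivalence relation generated by r and
    the pair (a, b). Each side absorbs every tie occurring in the other: for the
    right-hand side v, absorption of tie x z is a two-colouring of the points z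
    that is constant along r and along (a, b), hence along r'. *)
Lemma tie_rel_join r r' a b :
    (forall x y, r' x y <-> forall f : 'I_N.+1 -> bool,
       (forall u v, r u v -> f u = f v) -> f a = f b -> f x = f y) ->
  tie_rel r' = tie_rel r * tie a b.
Proof.
move=> r'P; set v := tie_rel r * tie a b.
have v_absorbs x y : r' x y -> v * tie x y = v.
  have vC c d : v * tie c d = v -> v * tie d c = v by rewrite tieC.
  have step c d z : v * tie c d = v -> (v * tie z c == v) = (v * tie z d == v).
    move=> vcd; apply/eqP/eqP => vz; first exact: absorb_trans vz vcd.
    by apply: absorb_trans vz _; apply: vC.
  move=> /r'P/(_ (fun z => v * tie x z == v)); rewrite tie_refl mulr1 eqxx.
  move=> H; apply/eqP/esym/H => [c d cd|]; apply: step.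
    by rewrite /v -mulrA (tie_comm a) mulrA tie_rel_absorb.
  by rewrite /v -mulrA tie_idem.
have r'_absorbs : tie_rel r' * v = tie_rel r'.
  rewrite /v mulrA absorb_tie_rel => [|c d cd]; apply: tie_rel_absorb.
    exact/r'P.
  by apply/r'P => f rf _; apply: rf.
rewrite -r'_absorbs -{2}(absorb_tie_rel v_absorbs) /v.
have comm c d : GRing.comm (tie_rel r') (tie c d) by apply: tie_rel_comm.
by apply: commrM => //; apply: commr_prod.
Qed.

End Ties.

(** * Diagrams and the basis of the small ramified partition algebra *)

Section Diag.
Variable n : nat.
Implicit Types (p q : diagram n) (s : 'S_n) (a b : 'I_n) (f g h : 'I_n -> bool).

Lemma colouring_joined a b f g :
  colouring (joined a b) f g <-> f =1 g /\ f a = f b.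
Proof.
have bigP : [set inl a; inr a; inl b; inr b] \in parts (joined a b).
  by rewrite !inE eqxx.
split=> [fg|[fg fab] x y].
  split; first exact: (diag_diagramsP _ (joined_diag a b)).
  apply: (fg (inl a) (inl b)); rewrite (same_partE _ bigP) ?inE ?eqxx ?orbT //.
have [B Bp xB] := mem_part (joined a b) x; rewrite (same_partE _ Bp xB) => yB.
move: Bp xB yB; rewrite !inE => /orP[/eqP->|/imsetP[k _ ->]]; rewrite !inE.
  by do 2!(move=> /orP[/orP[/orP[]|]|] /eqP->); rewrite /= -?fg ?fab.
by move=> /orP[]/eqP-> /orP[]/eqP->; rewrite /= ?fg.
Qed.

Lemma joined_refl a : joined a a = one_diagram n.
Proof.
apply: colouring_inj => f g; split.
  by move=> /colouring_joined[fg _]; apply/colouring_one.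
by move=> /colouring_one fg; apply/colouring_joined.
Qed.

Lemma joinedC a b : joined a b = joined b a.
Proof.
by apply: colouring_inj => f g; split=> /colouring_joined[fg fab];
  apply/colouring_joined.
Qed.

Lemma colouring_joinedl a b p f h :
  colouring (dcomp (joined a b) p) f h <-> f a = f b /\ colouring p f h.
Proof.
split=> [/colouring_comp[g [/colouring_joined[/funext<- fab]]] // |[fab pf]].
by apply/colouring_comp; exists f; split=> //; apply/colouring_joined.
Qed.

Lemma colouring_joinedr a b p f h :
  colouring (dcomp p (joined a b)) f h <-> colouring p f h /\ h a = h b.
Proof.
split=> [/colouring_comp[g [pg /colouring_joined[/funext<- gab]]] // |[pf hab]].
by apply/colouring_comp; exists h; split=> //; apply/colouring_joined.
Qed.

Lemma joined_comm a b c d :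
  dcomp (joined a b) (joined c d) = dcomp (joined c d) (joined a b).
Proof.
apply: colouring_inj => f h.
by split=> /colouring_joinedl[E1 /colouring_joined[fh E2]];
  apply/colouring_joinedl; split=> //; apply/colouring_joined.
Qed.

Lemma joined_idem a b : dcomp (joined a b) (joined a b) = joined a b.
Proof.
apply: colouring_inj => f h; split=> [/colouring_joinedl[] //|H].
by apply/colouring_joinedl; split=> //; case/colouring_joined: H.
Qed.

Lemma joined_trans a b c :
  dcomp (joined a b) (joined b c) = dcomp (joined a b) (joined a c).
Proof.
apply: colouring_inj => f h.
by split=> /colouring_joinedl[E1 /colouring_joined[fh E2]];
  apply/colouring_joinedl; split=> //; apply/colouring_joined; split=> //;
  congruence.
Qed.

Lemma joined_perm a b s : dcomp (joined a b) (perm_diagram s) =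
  dcomp (perm_diagram s) (joined (s a) (s b)).
Proof.
apply: colouring_inj => f h; split.
  move=> /colouring_joinedl[fab fh]; apply/colouring_joinedr; split=> //.
  by move/colouring_perm: fh fab => fh; rewrite !fh.
move=> /colouring_joinedr[fh hab]; apply/colouring_joinedl; split=> //.
by move/colouring_perm: fh => fh; rewrite !fh.
Qed.

Lemma same_part_perm s a b :
  same_part (perm_diagram s) (inl a) (inr b) = (s a == b).
Proof. by rewrite same_part_rel. Qed.

Lemma perm_diagram_inj : injective (@perm_diagram n).
Proof.
move=> s s' E; apply/permP => a; apply/eqP.
by rewrite -same_part_perm E same_part_perm.
Qed.

Lemma transpositionE a b : transposition a b = perm_diagram (tperm a b).
Proof.
have [s E] := sym_diagramsP _ (transposition_sym a b).
rewrite E; congr perm_diagram; apply/permP => k; apply/eqP.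
rewrite -same_part_perm -E.
have part A : A \in parts (transposition a b) -> inl k \in A ->
    inr (tperm a b k) \in A ->
    same_part (transposition a b) (inl k) (inr (tperm a b k)).
  by move=> Ap kA; rewrite (same_partE _ Ap).
case: tpermP part => [->|->|/eqP ka /eqP kb] part.
- by apply: (part [set inl a; inr b]); rewrite !inE !eqxx ?orbT.
- by apply: (part [set inl b; inr a]); rewrite !inE !eqxx ?orbT.
apply: (part [set inl k; inr k]); rewrite ?inE ?eqxx ?orbT //.
by apply/orP; right; apply: imset_f; rewrite !inE negb_or ka.
Qed.

Lemma perm_ltimes s : (perm_diagram s, perm_diagram s) \in ltimes_image n.
Proof.
apply/imsetP; exists (perm_diagram s, one_diagram n).
  by apply/setXP; split; [apply/sym_diagramsP; exists s|exact: one_diag].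
by rewrite /ltimes comp1d.
Qed.

Definition basis_perm s : ltimes_basis n := LtimesBasis (perm_ltimes s).
Definition basis_joined a b : ltimes_basis n := LtimesBasis (joined_ltimes a b).

Local Notation "d ⋅ e" := (basis_mul d e) (at level 40, left associativity).

Lemma basis_permM s s' : basis_perm (s * s')%g = basis_perm s ⋅ basis_perm s'.
Proof. by apply: val_inj; rewrite /= perm_diagramM. Qed.
Lemma basis_perm1 : basis_perm 1%g = basis_one n.
Proof. by apply: val_inj; rewrite /= perm_diagram1. Qed.
Lemma basis_joined_perm a b s :
  basis_joined a b ⋅ basis_perm s = basis_perm s ⋅ basis_joined (s a) (s b).
Proof. by apply: val_inj; rewrite /= comp1d compd1 joined_perm. Qed.
Lemma basis_joined_comm a b c d :
  basis_joined a b ⋅ basis_joined c d = basis_joined c d ⋅ basis_joined a b.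
Proof. by apply: val_inj; rewrite /= joined_comm. Qed.
Lemma basis_joined_idem a b :
  basis_joined a b ⋅ basis_joined a b = basis_joined a b.
Proof. by apply: val_inj; rewrite /= joined_idem comp1d. Qed.
Lemma basis_joined_trans a b c :
  basis_joined a b ⋅ basis_joined b c = basis_joined a b ⋅ basis_joined a c.
Proof. by apply: val_inj; rewrite /= joined_trans. Qed.
Lemma basis_joinedC a b : basis_joined a b = basis_joined b a.
Proof. by apply: val_inj; rewrite /= joinedC. Qed.
Lemma basis_joined_refl a : basis_joined a a = basis_one n.
Proof. by apply: val_inj; rewrite /= joined_refl. Qed.

Implicit Types d : ltimes_basis n.

Definition perm_of d : 'S_n :=
  odflt 1%g [pick s | (val d).1 == perm_diagram s].

Definition top_rel d : rel 'I_n :=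
  fun a b => same_part (val d).2 (inl a) (inl b).

Lemma perm_of_eq d s : (val d).1 = perm_diagram s -> perm_of d = s.
Proof.
rewrite /perm_of => E; case: pickP => [s'|/(_ s)]; last by rewrite E eqxx.
by rewrite E => /eqP/perm_diagram_inj.
Qed.

Lemma basisP d : (val d).1 = perm_diagram (perm_of d) /\
  forall f g, colouring (val d).2 f g -> f =1 g \o perm_of d.
Proof.
have /imsetP[[p b] /setXP[/= /sym_diagramsP[s ->] bP] dE] := valP d.
move: bP => /diag_diagramsP bP.
have d1 : (val d).1 = perm_diagram s := congr1 fst dE.
have d2 : (val d).2 = dcomp b (perm_diagram s) := congr1 snd dE.
rewrite (perm_of_eq d1); split=> // f g.
rewrite d2 => /colouring_comp[h [/bP fh /colouring_perm hg]] i.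
by rewrite fh hg.
Qed.

(** In the second component of a basis element every bottom vertex lies in the
    part of a top vertex, the one that the permutation sends to it. So a
    colouring amounts to a colouring of the top vertices. *)
Lemma colouring_basis d f g : colouring (val d).2 f g <->
  f =1 g \o perm_of d /\ forall a b, top_rel d a b -> f a = f b.
Proof.
have [_ dP] := basisP d.
split=> [fg|[fg ftop] x y]; first by split=> [|a b]; [exact: dP|exact: fg].
pose key (z : vertex n) : 'I_n :=
  match z with inl i => i | inr i => (perm_of d)^-1%g i end.
have keyP z : same_part (val d).2 z (inl (key z)).
  apply/same_partP => f' g' /dP fg'; case: z => //= i.
  by rewrite fg' /= permKV.
have keyE z : glue f g z = f (key z).
  by case: z => //= i; rewrite fg /= permKV.
move=> xy; rewrite !keyE; apply: ftop; rewrite /top_rel.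
apply: same_part_trans (same_part_trans xy (keyP y)).
by rewrite same_part_sym.
Qed.

Lemma basis_ext d d' : perm_of d = perm_of d' ->
  (forall f g, colouring (val d).2 f g <-> colouring (val d').2 f g) -> d = d'.
Proof.
move=> dd' /colouring_inj E2; apply: val_inj; move: E2.
have [E _] := basisP d; have [E' _] := basisP d'.
case: (val d) (val d') E E' => [p q] [p' q'] /= -> -> ->.
by rewrite dd'.
Qed.

Lemma perm_of_perm d s : perm_of (d ⋅ basis_perm s) = (perm_of d * s)%g.
Proof.
apply: perm_of_eq => /=; have [-> _] := basisP d.
by rewrite perm_diagramM.
Qed.

Lemma perm_of_joined d a b : perm_of (d ⋅ basis_joined a b) = perm_of d.
Proof.
by apply: perm_of_eq => /=; rewrite compd1; have [] := basisP d.
Qed.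

Lemma top_rel_perm d s : top_rel (d ⋅ basis_perm s) =2 top_rel d.
Proof.
move=> a b; apply/idP/idP => /same_partP H; apply/same_partP => f g fg.
  apply: (H f (g \o s^-1%g)); apply/colouring_comp; exists g; split=> //.
  by apply/colouring_perm => i /=; rewrite permK.
by move: fg => /colouring_comp[h [fh _]]; apply: H fh.
Qed.

(** The bottom vertices s a and s b lie in the parts of the top vertices a and b;
    the right-hand side describes, by its two-colourings, the equivalence
    relation generated by the top relation of d and the pair (a, b). *)
Lemma top_rel_joined d a b x y : let s := perm_of d in
  top_rel (d ⋅ basis_joined (s a) (s b)) x y <->
  forall f, (forall u v, top_rel d u v -> f u = f v) -> f a = f b -> f x = f y.
Proof.
move=> s; split=> [xy f ftop fab|H].
  have /same_partP/(_ f (f \o s^-1%g)) := xy; apply.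
  apply/colouring_joinedr; rewrite /= !permK; split=> //.
  by apply/colouring_basis; split=> // i /=; rewrite permK.
apply/same_partP => f g /colouring_joinedr[/colouring_basis[fg ftop] gab].
by apply: H => //; rewrite !fg.
Qed.

End Diag.

(** * Homomorphisms out of a presented algebra and a base change *)

(** The universal property of a presentation over A concerns A-algebras, whereas
    the target here is an algebra over the field at which u is specialised. *)
Definition restriction (A K : comNzRingType) (f : {rmorphism A -> K})
  (B : algType K) : Type := B.

Section Restriction.
Variables (A K : comNzRingType) (f : {rmorphism A -> K}) (B : algType K).
Local Notation rB := (restriction f B).

HB.instance Definition _ := GRing.NzRing.on rB.

Definition restriction_scale (a : A) (x : rB) : rB := f a *: (x : B).

Lemma restriction_scaleA a b x :
  restriction_scale a (restriction_scale b x) = restriction_scale (a * b) x.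
Proof. by rewrite /restriction_scale scalerA rmorphM. Qed.
Lemma restriction_scale1 : left_id 1 restriction_scale.
Proof. by move=> x; rewrite /restriction_scale rmorph1 scale1r. Qed.
Lemma restriction_scaleDr : right_distributive restriction_scale +%R.
Proof. by move=> a x y; apply: scalerDr. Qed.
Lemma restriction_scaleDl x : {morph restriction_scale^~ x : a b / a + b}.
Proof. by move=> a b; rewrite /restriction_scale rmorphD scalerDl. Qed.

HB.instance Definition _ := GRing.Zmodule_isLmodule.Build A rB
  restriction_scaleA restriction_scale1 restriction_scaleDr restriction_scaleDl.

Lemma restriction_scaleAl a (x y : rB) : a *: (x * y) = a *: x * y.
Proof. exact: (@scalerAl _ B). Qed.
Lemma restriction_scaleAr a (x y : rB) : a *: (x * y) = x * (a *: y).
Proof. exact: (@scalerAr _ B). Qed.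

HB.instance Definition _ :=
  GRing.Lmodule_isLalgebra.Build A rB restriction_scaleAl.
HB.instance Definition _ :=
  GRing.Lalgebra_isAlgebra.Build A rB restriction_scaleAr.

Lemma restriction_scaleE a (x : rB) : a *: x = f a *: (x : B).
Proof. by []. Qed.
End Restriction.

(** A multiplicative map out of E that is linear over f extends to the base
    change of E along f. *)
Section TensLift.
Variables (A K : comNzRingType) (f : {rmorphism A -> K}) (E : algType A).
Variables (B : algType K) (g : E -> B).
Hypothesis gD : {morph g : x y / x + y}.
Hypothesis gM : {morph g : x y / x * y}.
Hypothesis g1 : g 1 = 1.
Hypothesis gZ : forall a x, g (a *: x) = f a *: g x.

Definition tens_sum (s : seq (E * K)) : B := \sum_(x <- s) x.2 *: g x.1.
Definition tens_lift (x : base_change f E) : B := tens_sum (repr x).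

Lemma tens_sum_congr s t : tens_congr f s t -> tens_sum s = tens_sum t.
Proof.
have g0 : g 0 = 0 by apply: (addrI (g 0)); rewrite -gD !addr0.
rewrite /tens_sum; elim=> {s t} //.
- by move=> s t w _ -> _ ->.
- by move=> s s' t t' _ ss' _ tt'; rewrite !big_cat /= ss' tt'.
- by move=> s t; rewrite !big_cat /= addrC.
- by move=> *; rewrite !big_cons !big_nil /= !addr0 gD scalerDr.
- by move=> *; rewrite !big_cons !big_nil /= !addr0 scalerDl.
- by move=> *; rewrite big_nil big_seq1 /= g0 scaler0.
- by move=> *; rewrite big_nil big_seq1 /= scale0r.
- by move=> a *; rewrite !big_seq1 /= gZ scalerA [f a * _]mulrC.
Qed.

Lemma tens_liftE s : tens_lift (tclass f s) = tens_sum s.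
Proof. exact/tens_sum_congr/repr_tclass. Qed.

Lemma tens_lift_tens e : tens_lift (tens f e 1) = g e.
Proof. by rewrite tens_liftE /tens_sum big_seq1 scale1r. Qed.

Lemma tens_liftD : {morph tens_lift : x y / x + y}.
Proof.
move=> x y; case: (trepr x) (trepr y) => s -> [t ->].
by rewrite [X in tens_lift X]taddE !tens_liftE /tens_sum big_cat.
Qed.

Lemma tens_liftM : {morph tens_lift : x y / x * y}.
Proof.
move=> x y; case: (trepr x) (trepr y) => s -> [t ->].
rewrite [X in tens_lift X]tmulE !tens_liftE /tens_sum.
rewrite big_allpairs_dep /= mulr_suml; apply: eq_bigr => a _.
rewrite mulr_sumr; apply: eq_bigr => b _ /=.
by rewrite gM -scalerAl -scalerAr scalerA.
Qed.

Lemma tens_lift1 : tens_lift 1 = 1.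
Proof. by rewrite [LHS]tens_lift_tens. Qed.

Lemma tens_liftZ a : {morph tens_lift : x / a *: x}.
Proof.
move=> x; case: (trepr x) => s ->.
rewrite [X in tens_lift X]tscaleE !tens_liftE /tens_sum big_map scaler_sumr.
by apply: eq_bigr => b _; rewrite scalerA.
Qed.

End TensLift.

Section Tens1.
Variables (A K : comNzRingType) (f : {rmorphism A -> K}) (E : algType A).
Local Notation iota x := (tens f (x : E) 1).

Lemma tens1D x y : iota (x + y) = iota x + iota y.
Proof. by rewrite /tens [RHS]taddE; apply/tclassP; apply: tc_addl. Qed.
Lemma tens1M x y : iota (x * y) = iota x * iota y.
Proof. by rewrite /tens [RHS]tmulE /seq_mul /= mulr1. Qed.
Lemma tens1Z a x : iota (a *: x) = f a *: iota x.
Proof. by rewrite /tens [RHS]tscaleE; apply/tclassP; apply: tc_scale. Qed.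
Lemma tens_scale (x : E) c : tens f x c = c *: iota x.
Proof. by rewrite /tens [RHS]tscaleE /= mulr1. Qed.

Lemma base_change_ind (Q : base_change f E -> Prop) :
    Q 0 -> (forall x y, Q x -> Q y -> Q (x + y)) ->
    (forall c x, Q x -> Q (c *: x)) -> (forall x, Q (iota x)) ->
  forall x, Q x.
Proof.
move=> Q0 QD QZ Qi x; case: (trepr x) => s ->; elim: s => [|[y c] s IHs] //.
rewrite -cat1s -taddE; apply: QD IHs.
by rewrite -[tclass _ _]/(tens f y c) tens_scale; apply/QZ/Qi.
Qed.

End Tens1.

Section PresentedLift.
Variables (A : comNzRingType) (X : Type) (r : term A X -> term A X -> Prop).
Variables (B : algType A) (g : X -> B).
Hypothesis rg : forall s t, r s t -> term_eval g s = term_eval g t.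
Local Notation lift := (@presented_lift A X r B g).

Lemma presented_liftD : {morph lift : x y / x + y}.
Proof.
move=> x y; case: (prepr x) (prepr y) => s -> [t ->].
by rewrite [X in lift X]paddE !presented_liftE.
Qed.
Lemma presented_liftM : {morph lift : x y / x * y}.
Proof.
move=> x y; case: (prepr x) (prepr y) => s -> [t ->].
by rewrite [X in lift X]pmulE !presented_liftE.
Qed.
Lemma presented_liftZ a : {morph lift : x / a *: x}.
Proof.
move=> x; case: (prepr x) => s ->.
by rewrite [X in lift X]pscaleE !presented_liftE.
Qed.
Lemma presented_lift1 : lift 1 = 1.
Proof. by rewrite [LHS]presented_liftE. Qed.
End PresentedLift.

Lemma presented_ind (A : comNzRingType) (X : Type)
    (r : term A X -> term A X -> Prop) (Q : presented r -> Prop) :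
    (forall x, Q (pclass r (Gen x))) -> Q 1 ->
    (forall x y, Q x -> Q y -> Q (x + y)) ->
    (forall x y, Q x -> Q y -> Q (x * y)) -> (forall c x, Q x -> Q (c *: x)) ->
  forall x, Q x.
Proof.
move=> Qgen Q1 QD QM QZ x; case: (prepr x) => s -> {x}.
elim: s => [x|||s IHs t IHt|s IHs|s IHs t IHt|a s IHs] //.
- suff -> : pclass r Zero = 0 *: (1 : presented r) by apply: QZ.
  by rewrite scale0r.
- by rewrite -paddE; apply: QD.
- suff -> : pclass r (Opp s) = -1 *: pclass r s by apply: QZ.
  by rewrite scaleN1r [RHS]poppE.
- by rewrite -pmulE; apply: QM.
- by rewrite -pscaleE; apply: QZ.
Qed.

(** * The homomorphism phi *)

Section Phi.
Variables (F : fieldType) (N : nat).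
Local Notation P := (small_ramified F N.+1).
Local Notation ev := (laurent_eval (oner_neq0 F)).
Local Notation JA := (juyumaya (laurentX F) N.+1).
Local Notation J := (juyumaya_at (oner_neq0 F) N.+1).
Local Notation beta := (@basis_elt F N.+1).
Local Notation node := (node N).
Local Notation swap := (swap N).

Lemma basis_eltM d e : beta d * beta e = beta (basis_mul d e).
Proof. exact: sr_mulE. Qed.

Lemma fst_node (i : 'I_N) : @fst_index N.+1 i = node i.
Proof. by apply: val_inj; rewrite /= inordK // ltnW ?ltnS. Qed.
Lemma snd_node (i : 'I_N) : @snd_index N.+1 i = node i.+1.
Proof. by apply: val_inj; rewrite /= inordK ?ltnS. Qed.

Lemma image_EE (i : 'I_N) :
  @image_E F N.+1 i = beta (basis_joined (node i) (node i.+1)).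
Proof. by rewrite /image_E fst_node snd_node. Qed.

Lemma image_TE (i : 'I_N) : @image_T F N.+1 i = beta (basis_perm (swap i)).
Proof.
congr beta; apply: val_inj => /=.
by rewrite transpositionE fst_node snd_node.
Qed.

Local Notation "d ⋅ e" := (basis_mul d e) (at level 40, left associativity).
Local Notation bt i := (basis_perm (swap i)).
Local Notation be i := (basis_joined (node i) (node i.+1)).

Lemma basis_joined_far i j :
    (i < N)%N -> (j < N)%N -> (i.+1 < j)%N || (j.+1 < i)%N ->
  be i ⋅ bt j = bt j ⋅ be i.
Proof. by move=> iN jN ij; rewrite basis_joined_perm !swapD //; lia. Qed.

Lemma basis_joined_swap i : be i ⋅ bt i = bt i ⋅ be i.
Proof. by rewrite basis_joined_perm swapL swapR basis_joinedC. Qed.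

Lemma basis_joined_shift i j :
    (i < N)%N -> (j < N)%N -> (i.+1 == j)%N || (j.+1 == i)%N ->
  be j ⋅ bt i ⋅ bt j = bt i ⋅ bt j ⋅ be i.
Proof.
move=> iN jN ij; rewrite -!basis_mulA -basis_permM basis_mulA -basis_permM.
rewrite basis_joined_perm !permM.
suff [-> ->] : swap j (swap i (node j)) = node i /\
               swap j (swap i (node j.+1)) = node i.+1 by [].
case/orP: ij jN iN => /eqP<- jN iN.
  by rewrite swapR swapD; try lia; rewrite swapD ?swapR //; lia.
rewrite swapD; try lia; rewrite swapL; split=> //.
by rewrite swapL swapD //; lia.
Qed.

(** This is transitivity of joining: the swap of node j and node j.+1 moves the
    end that be i shares with be j to the other end of be j. *)
Lemma basis_joined_swap_trans i j :
    (i < N)%N -> (j < N)%N -> (i.+1 == j)%N || (j.+1 == i)%N ->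
  be i ⋅ be j = be i ⋅ basis_joined (swap j (node i)) (swap j (node i.+1)).
Proof.
move=> iN jN /orP[] /eqP E; move: iN jN; rewrite -E => iN jN.
  by rewrite basis_joined_trans swapL swapD //; lia.
rewrite swapR [swap j _]swapD; try lia.
rewrite basis_joinedC [basis_joined (node j) _]basis_joinedC.
by rewrite basis_joined_trans [basis_joined _ (node j)]basis_joinedC.
Qed.

Lemma swap_invol i x : swap i (swap i x) = x.
Proof. exact: tpermK. Qed.

Definition gen_image (x : juyumaya_gen N.+1) : restriction ev P :=
  match x with GenT i => image_T F i | GenE i => image_E F i end.

Lemma laurent_eval_quadratic : ev (laurentX F - 1) = 0.
Proof. by rewrite rmorphB rmorph1 /= laurent_evalX subrr. Qed.

Lemma gen_image_rel s t : juyumaya_rel (laurentX F) s t ->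
  term_eval gen_image s = term_eval gen_image t.
Proof.
have [sq far braid] := swap_coxeter N.
have mE (d e : ltimes_basis N.+1) :
    (beta d : restriction ev P) * beta e = beta (basis_mul d e).
  exact: basis_eltM.
case=> /= => [i j|i j|i|i|i j|i j|i j|i j|i j|i];
  rewrite ?image_TE ?image_EE ?mE.
- move=> /orP[] ij; congr beta; rewrite -!basis_permM; congr basis_perm.
    by apply: far; rewrite ij /=.
  by apply/esym/far; rewrite ij /=.
- by congr beta; rewrite basis_joined_comm.
- by congr beta; rewrite basis_joined_idem.
- by congr beta; rewrite basis_joined_swap.
- by move=> ij; congr beta; rewrite basis_joined_far.
- by move=> ij; congr beta; rewrite -!basis_permM -!mulgA;
    case/orP: ij (ltn_ord i) (ltn_ord j) => /eqP<- iN jN; rewrite braid.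
- by move=> ij; congr beta; rewrite basis_joined_shift.
- move=> ij; congr beta; rewrite basis_joined_swap_trans // -!basis_mulA.
  by rewrite basis_joined_perm !swap_invol.
- move=> ij; congr beta; rewrite basis_joined_perm -!basis_mulA; congr (_ ⋅ _).
  by rewrite basis_joined_swap_trans // basis_joined_comm.
- rewrite -basis_permM sq // basis_perm1 [_ *: _](_ : _ = 0) ?addr0 //.
  by rewrite restriction_scaleE [X in X *: _]laurent_eval_quadratic scale0r.
Qed.

Local Notation lift_gen_image :=
  (@presented_lift _ _ (@juyumaya_rel _ (laurentX F) N.+1) _ gen_image).

Definition phi : J -> P := @tens_lift _ _ ev JA P lift_gen_image.

Let gD : {morph (lift_gen_image : JA -> P) : x y / x + y} :=
  presented_liftD gen_image_rel.
Let gM : {morph (lift_gen_image : JA -> P) : x y / x * y} :=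
  presented_liftM gen_image_rel.
Let g1 : (lift_gen_image : JA -> P) 1 = 1 :=
  presented_lift1 gen_image_rel.
Let gZ a (x : JA) :
    (lift_gen_image : JA -> P) (a *: x) = ev a *: lift_gen_image x :=
  presented_liftZ gen_image_rel a x.

Lemma phi_zmod_morphism : zmod_morphism phi.
Proof.
move=> x y; rewrite -[- y]scaleN1r -[- phi y]scaleN1r.
by rewrite [LHS](tens_liftD gD gZ) [X in _ + X](tens_liftZ gD gZ).
Qed.

Lemma phi_monoid_morphism : monoid_morphism phi.
Proof.
by split; [exact: (tens_lift1 gD g1 gZ)|exact: (tens_liftM gD gM gZ)].
Qed.

Lemma phi_scalable : scalable phi.
Proof. exact: (tens_liftZ gD gZ). Qed.

HB.instance Definition _ :=
  GRing.isZmodMorphism.Build J P phi phi_zmod_morphism.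
HB.instance Definition _ :=
  GRing.isMonoidMorphism.Build J P phi phi_monoid_morphism.
HB.instance Definition _ := GRing.isScalable.Build F J P *:%R phi phi_scalable.

Lemma phi_gen_E i : phi (gen_E (oner_neq0 F) i) = image_E F i.
Proof.
rewrite [LHS](tens_lift_tens gD gZ).
exact: (presented_liftE gen_image_rel).
Qed.

Lemma phi_gen_T i : phi (gen_T (oner_neq0 F) i) = image_T F i.
Proof.
rewrite [LHS](tens_lift_tens gD gZ).
exact: (presented_liftE gen_image_rel).
Qed.

(** * The inverse map *)

Local Notation genE := (@gen_E F _ (oner_neq0 F) N.+1).
Local Notation genT := (@gen_T F _ (oner_neq0 F) N.+1).

Definition class s : J := tens ev (pclass _ s : JA) 1.

Lemma juyumaya_at_ind (Q : J -> Prop) :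
    (forall i, Q (genT i)) -> (forall i, Q (genE i)) -> Q 1 ->
    (forall x y, Q x -> Q y -> Q (x + y)) ->
    (forall x y, Q x -> Q y -> Q (x * y)) -> (forall c x, Q x -> Q (c *: x)) ->
  forall x, Q x.
Proof.
move=> QT QE Q1 QD QM QZ; apply: base_change_ind => //.
  by rewrite -[X in Q X](scale0r (1 : J)); apply: QZ.
apply: presented_ind => [[i|i]||x y Qx Qy|x y Qx Qy|a x Qx]; first exact: QT.
- exact: QE.
- exact: Q1.
- by rewrite tens1D; apply: QD.
- by rewrite tens1M; apply: QM.
- by rewrite tens1Z; apply: QZ.
Qed.

Lemma classM s t : class (Mul s t) = class s * class t.
Proof. by rewrite /class -pmulE; apply: tens1M. Qed.

Lemma class_rel s t : juyumaya_rel (laurentX F) s t -> class s = class t.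
Proof.
by move=> st; rewrite /class (proj2 (pclassP _ s t)) //; apply: ac_rel.
Qed.

(** The default value x0 serves only to index a family by natural numbers. *)
Definition extend (X : Type) (x0 : X) (h : 'I_N -> X) (i : nat) : X :=
  if insub i is Some o then h o else x0.

Lemma extendE X x0 (h : 'I_N -> X) (i : 'I_N) : extend x0 h i = h i.
Proof. by rewrite /extend valK. Qed.

Local Notation T := (extend (1 : J) genT).
Local Notation E := (extend (1 : J) genE).

Lemma juyumaya_at_ties : ties_family N T E.
Proof.
have ord i : (i < N)%N -> exists o : 'I_N, i = o.
  by move=> iN; exists (Ordinal iN).
have ord2 i : (i.+1 < N)%N -> exists o o' : 'I_N,
    [/\ i = o, i.+1 = o' & @adjacent N.+1 o o' && @adjacent N.+1 o' o].
  move=> iN; exists (Ordinal (ltnW iN)), (Ordinal iN); split=> //.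
  by rewrite /adjacent /= eqxx orbT.
have ord_far i j : (i.+1 < j < N)%N ->
    exists o o' : 'I_N, [/\ i = o, j = o' & @Defs.far N.+1 o o'].
  move=> /andP[ij jN]; have iN : (i < N)%N by lia.
  by exists (Ordinal iN), (Ordinal jN); rewrite /Defs.far /= ij.
have rel s t := @class_rel s t.
split; first split.
- move=> _ /ord[i ->] /=; rewrite extendE.
  have := rel _ _ (@jrA9 _ (laurentX F) N.+1 i); rewrite classM => ->.
  rewrite /class -paddE tens1D -pscaleE tens1Z.
  by rewrite [X in X *: _]laurent_eval_quadratic scale0r addr0.
- move=> _ _ /ord_far[i [j [-> -> ij]]] /=; rewrite !extendE.
  by have := rel _ _ (jrA1 (laurentX F) ij); rewrite !classM.
- move=> _ /ord2[i [j [-> -> /andP[ij ji]]]] /=; rewrite !extendE.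
  by have := rel _ _ (jrA6 (laurentX F) ij); rewrite !classM !mulrA.
- move=> _ _ /ord[i ->] /ord[j ->]; rewrite !extendE.
  by have := rel _ _ (@jrA2 _ (laurentX F) N.+1 i j); rewrite !classM.
- move=> _ /ord[i ->]; rewrite !extendE.
  by have := rel _ _ (@jrA3 _ (laurentX F) N.+1 i); rewrite !classM.
- move=> _ /ord[i ->]; rewrite !extendE.
  by have := rel _ _ (@jrA4 _ (laurentX F) N.+1 i); rewrite !classM.
- move=> _ _ /ord_far[i [j [-> -> ij]]] /=; rewrite !extendE.
  by have := rel _ _ (jrA5 (laurentX F) ij); rewrite !classM.
- move=> _ /ord2[i [j [-> -> /andP[ij ji]]]] /=; rewrite !extendE.
  by have := rel _ _ (jrA7 (laurentX F) ij); rewrite !classM.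
- move=> _ /ord2[i [j [-> -> /andP[ij ji]]]] /=; rewrite !extendE.
  by have := rel _ _ (jrA8l (laurentX F) ij); rewrite !classM.
Qed.

Local Notation tauJ := (tau T).
Local Notation tieJ := (tie T E).
Local Notation tie_relJ := (@tie_rel N _ T E).
Let tiesP := juyumaya_at_ties.

Definition psi_basis (d : ltimes_basis N.+1) : J :=
  tie_relJ (top_rel d) * tauJ (perm_of d).

Lemma psi_basis_perm d i : (i < N)%N ->
  psi_basis (d ⋅ bt i) = psi_basis d * T i.
Proof.
move=> iN; rewrite /psi_basis perm_of_perm (eq_tie_rel _ _ (top_rel_perm _ _)).
by rewrite (tauM tiesP) (tau_swap tiesP) // mulrA.
Qed.

Lemma psi_basis_joined d a b :
  psi_basis (d ⋅ basis_joined (perm_of d a) (perm_of d b)) =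
  psi_basis d * tieJ (perm_of d a) (perm_of d b).
Proof.
rewrite /psi_basis perm_of_joined -mulrA (tau_tie tiesP) mulrA.
congr (_ * _); apply: (tie_rel_join tiesP) => x y.
exact: top_rel_joined.
Qed.

Definition psi (p : P) : J := \sum_d p d *: psi_basis d.

Lemma psiD p q : psi (p + q) = psi p + psi q.
Proof.
rewrite /psi -big_split; apply: eq_bigr => d _.
by rewrite ffunE scalerDl.
Qed.

Lemma psiZ c p : psi (c *: p) = c *: psi p.
Proof.
rewrite /psi scaler_sumr; apply: eq_bigr => d _.
by rewrite ffunE scalerA.
Qed.

Lemma psi_sum (I : finType) (G : I -> P) : psi (\sum_i G i) = \sum_i psi (G i).
Proof.
apply: (big_morph psi psiD); rewrite /psi big1 // => d _.
by rewrite ffunE scale0r.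
Qed.

Lemma psi_basis_elt d : psi (beta d) = psi_basis d.
Proof.
rewrite /psi (bigD1 d) //= basis_eltE eqxx scale1r big1 ?addr0 // => d' dd'.
by rewrite basis_eltE (negbTE dd') scale0r.
Qed.

Lemma psi_mul (x : J) (y : P) :
    (forall d, psi (beta d * y) = psi_basis d * x) ->
  forall p, psi (p * y) = psi p * x.
Proof.
move=> xy p; rewrite {1}[p]sr_expand mulr_suml psi_sum [in RHS]/psi mulr_suml.
by apply: eq_bigr => d _; rewrite -!scalerAl psiZ xy.
Qed.

(** The elements x with this property form a subalgebra, so it is enough to
    check the generators. There it expresses that right multiplication by a
    transposition changes only the permutation, and that joining two bottom
    vertices adds one pair to the top relation. *)
Lemma psi_phi_mul x p : psi (p * phi x) = psi p * x.
Proof.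
elim/juyumaya_at_ind: x p => [i|i||x y IHx IHy|x y IHx IHy|c x IHx].
- apply: psi_mul => d; rewrite phi_gen_T image_TE basis_eltM psi_basis_elt.
  by rewrite psi_basis_perm // extendE.
- apply: psi_mul => d; rewrite phi_gen_E image_EE basis_eltM psi_basis_elt.
  have := psi_basis_joined d
    ((perm_of d)^-1%g (node i)) ((perm_of d)^-1%g (node i.+1)).
  by rewrite !permKV (tie_node tiesP) // extendE.
- by move=> p; rewrite rmorph1 !mulr1.
- by move=> p; rewrite rmorphD !mulrDr psiD IHx IHy.
- by move=> p; rewrite rmorphM !mulrA IHy IHx.
- by move=> p; rewrite linearZ -!scalerAr psiZ IHx.
Qed.

Lemma phiK : cancel phi psi.
Proof.
move=> x; rewrite -[phi x]mul1r psi_phi_mul (_ : psi 1 = 1) ?mul1r //.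
rewrite (psi_basis_elt (basis_one _)) /psi_basis (_ : perm_of _ = 1%g).
  rewrite (tau1 tiesP) mulr1 /tie_rel big1 // => -[a b] /=.
  rewrite /top_rel => /same_partP ab.
  suff -> : a = b by apply: tie_refl.
  (* The identity diagram admits the colouring that singles out a. *)
  have := ab (pred1 a) (pred1 a).
  rewrite /= eqxx => H; apply/esym/eqP; rewrite -H //.
  by apply/colouring_one.
by apply: perm_of_eq; rewrite /= perm_diagram1.
Qed.

Lemma phi_tau s : phi (tauJ s) = beta (basis_perm s).
Proof.
rewrite -{2}(wperm_word s) /tau; elim: (word s) (word_letters s) => [_|i u IHu].
  by rewrite big_nil /wperm big_nil rmorph1 basis_perm1.
move=> /andP[/= iN /IHu E1].
rewrite /wperm !big_cons rmorphM /= E1 basis_permM -basis_eltM; congr (_ * _).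
have -> : i = Ordinal iN by [].
by rewrite extendE phi_gen_T image_TE.
Qed.

Lemma phi_tie a b : phi (tieJ a b) = beta (basis_joined a b).
Proof.
have [->|/carryP[g [N0 <- <-]]] := eqVneq a b.
  by rewrite tie_refl rmorph1 basis_joined_refl.
rewrite (tie0E tiesP) // /conj_tau !rmorphM /= !phi_tau.
have -> : E 0 = genE (Ordinal N0).
  by rewrite -[0%N]/(nat_of_ord (Ordinal N0)) extendE.
rewrite phi_gen_E image_EE.
rewrite !basis_eltM -basis_mulA basis_joined_perm basis_mulA -basis_permM.
by rewrite mulVg basis_perm1 basis_mul1l.
Qed.

(** The diagram found is the diagonal one whose parts are generated by r. *)
Lemma phi_tie_rel r : exists d, [/\ phi (tie_relJ r) = beta d, perm_of d = 1%g &
  forall f g, colouring (val d).2 f g <->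
    f =1 g /\ forall a b, r a b -> f a = f b].
Proof.
suff H (l : seq ('I_N.+1 * 'I_N.+1)) :
    exists d, [/\ phi (\prod_(p <- l) tieJ p.1 p.2) = beta d, perm_of d = 1%g &
      forall f g, colouring (val d).2 f g <->
        f =1 g /\ forall p, p \in l -> f p.1 = f p.2].
  rewrite /tie_rel -big_filter.
  have [d [dE d1 dP]] := H [seq p <- index_enum _ | r p.1 p.2].
  exists d; split=> // f g; split=> [/dP[fg fl]|[fg fr]].
    split=> // a b rab; apply: (fl (a, b)).
    by rewrite mem_filter rab mem_index_enum.
  by apply/dP; split=> // -[a b]; rewrite mem_filter => /andP[/fr].
elim: l => [|[a b] l [d [dE d1 dP]]].
  exists (basis_one _); rewrite big_nil rmorph1; split=> //.
    by apply: perm_of_eq; rewrite /= perm_diagram1.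
  by move=> f g; split=> [/colouring_one|[fg _]]; [split|apply/colouring_one].
exists (basis_joined a b ⋅ d).
rewrite big_cons rmorphM /= dE phi_tie basis_eltM; split=> //.
  by apply: perm_of_eq => /=; rewrite comp1d -d1; have [] := basisP d.
move=> f g; split=> [/colouring_joinedl[fab /dP[fg fl]]|[fg fl]].
  by split=> // p; rewrite inE => /orP[/eqP->|/fl].
apply/colouring_joinedl; split; first by apply: (fl (a, b)); rewrite mem_head.
by apply/dP; split=> // p pl; apply: fl; rewrite inE pl orbT.
Qed.

(** Both sides have the same permutation, and the same colourings, namely those
    prescribed by the permutation and the top relation of d. *)
Lemma psiK_basis d : phi (psi_basis d) = beta d.
Proof.
rewrite rmorphM /= phi_tau; have [d' [-> d'1 d'P]] := phi_tie_rel (top_rel d).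
rewrite basis_eltM; congr beta; apply: basis_ext.
  by rewrite perm_of_perm d'1 mul1g.
move=> f g; split.
  move=> /colouring_comp[h [/d'P[fh ftop] /colouring_perm hg]].
  by apply/colouring_basis; split=> // i; rewrite fh hg.
move=> /colouring_basis[fg ftop]; apply/colouring_comp; exists f; split.
  exact/d'P.
exact/colouring_perm.
Qed.

Lemma psiK : cancel psi phi.
Proof.
move=> p; rewrite [RHS]sr_expand linear_sum /=; apply: eq_bigr => d _.
by rewrite linearZ /= psiK_basis.
Qed.

Lemma juyumaya_iso :
  exists f : {lrmorphism J -> P},
    [/\ forall i, f (genE i) = image_E F i, forall i, f (genT i) = image_T F i,
        forall f' : {lrmorphism J -> P},
          (forall i, f' (genE i) = image_E F i) ->
          (forall i, f' (genT i) = image_T F i) -> f' =1 f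
      & bijective f].
Proof.
exists phi; split=> [||f fE fT|]; [exact: phi_gen_E|exact: phi_gen_T| |].
  elim/juyumaya_at_ind => [i|i||x y fx fy|x y fx fy|c x fx].
  - by rewrite fT [RHS]phi_gen_T.
  - by rewrite fE [RHS]phi_gen_E.
  - by rewrite !rmorph1.
  - by rewrite !rmorphD /= fx fy.
  - by rewrite !rmorphM /= fx fy.
  - by rewrite !linearZ /= fx.
by exists psi; [exact: phiK|exact: psiK].
Qed.

End Phi.

Theorem theorem4p2 (R : realType) (n : nat) (n_gt0 : (1 <= n)%N) :
  exists phi : {lrmorphism juyumaya_at (oner_neq0 R[i]) n
                           -> small_ramified R[i] n},
    [/\ forall i : 'I_n.-1, phi (gen_E (oner_neq0 R[i]) i) = image_E R[i] i,
        forall i : 'I_n.-1, phi (gen_T (oner_neq0 R[i]) i) = image_T R[i] i,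
        forall psi : {lrmorphism juyumaya_at (oner_neq0 R[i]) n
                                 -> small_ramified R[i] n},
          (forall i : 'I_n.-1,
             psi (gen_E (oner_neq0 R[i]) i) = image_E R[i] i) ->
          (forall i : 'I_n.-1,
             psi (gen_T (oner_neq0 R[i]) i) = image_T R[i] i) ->
          psi =1 phi
      & bijective phi].
Proof. by case: n n_gt0 => // N _; exact: juyumaya_iso. Qed.
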